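(* Let $L$ be an honest time satisfying condition $(\mathbf{A})$: $\mathbb{P}[L=T]=0$ for every $(\mathcal{F}_t)$-stopping time $T$. Let $M$ be an $L^2$-bounded $(\mathcal{F}_t)$-martingale and let $M^L\equiv\mathbb{E}[M_\infty\mid\mathcal{F}_L]$. Then the martingale $$M_t-\mathbb{E}[M^L\mid\mathcal{F}_t]$$ belongs to $\mathcal{S}_2$, i.e. writing $N_t$ for this martingale, $\mathbb{E}[N_\infty\mid\mathcal{F}_L]=N_L$.
   Context: $(\Omega,\mathcal{F},(\mathcal{F}_t)_{t\ge0},\mathbb{P})$ is a filtered probability space satisfying the usual hypotheses; martingales are taken càdlàg. An honest time is a random time $L:\Omega\to\mathbb{R}_+$ which is the end of an $(\mathcal{F}_t)$-optional set $\Gamma$, $L=\sup\{t:(t,\omega)\in\Gamma\}$; it is assumed that $\mathbb{P}[L=0]=\mathbb{P}[L=\infty]=0$. $\mathcal{F}_L=\sigma\{z_L:\ z\text{ any }(\mathcal{F}_t)\text{-optional process}\}$. $\mathcal{H}^1$ is the space of càdlàg $(\mathcal{F}_t)$-martingales with $\mathbb{E}[\sup_t|M_t|]<\infty$, and $\mathcal{S}_2=\{M\in\mathcal{H}^1:\ \mathbb{E}[M_\infty\mid\mathcal{F}_L]=M_L\}$. *)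

(* Defs.v *)
From HB Require Import structures.
From mathcomp Require Import all_boot all_order all_algebra.
From mathcomp Require Import all_classical all_reals all_analysis.
From mathcomp Require Import measurable_realfun.
Set Implicit Arguments.
Unset Strict Implicit.
Unset Printing Implicit Defensive.
Import Order.TTheory GRing.Theory Num.Theory.
Import numFieldNormedType.Exports.
Local Open Scope classical_set_scope.
Local Open Scope ring_scope.

(* The time set is [0, +oo[. A process is a function X : R -> T -> R, and a
   filtration a function F : R -> set (set T); their values at negative times
   are junk, unconstrained and never used. Random times take values in
   [0, +oo], as extended reals. *)

Section general_theory.
Context (R : realType) (d : measure_display) (T : measurableType d)
        (P : probability T R).

Definition borel : set (set R) := @measurable _ R.

Definition measurable_wrt (G : set (set T)) (X : T -> R) : Prop :=
  preimage_set_system setT X borel `<=` G.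

(* Y is a version of the conditional expectation E[X | G]. *)
Definition is_condexp (G : set (set T)) (X Y : T -> R) : Prop :=
  [/\ P.-integrable setT (EFin \o X),
      P.-integrable setT (EFin \o Y),
      measurable_wrt G Y &
      forall A, G A ->
        (\int[P]_(w in A) (Y w)%:E = \int[P]_(w in A) (X w)%:E)%E].

Definition filtration (F : R -> set (set T)) : Prop :=
  [/\ forall t, 0 <= t -> sigma_algebra setT (F t),
      forall t, 0 <= t -> F t `<=` measurable &
      forall s t, 0 <= s -> s <= t -> F s `<=` F t].

(* The second clause makes P complete, since F 0 `<=` measurable. *)
Definition usual_conditions (F : R -> set (set T)) : Prop :=
  [/\ filtration F,
      forall N, P.-negligible N -> F 0 N &
      forall t, 0 <= t -> F t = \bigcap_(s in [set s | t < s]) F s].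

Definition adapted (F : R -> set (set T)) (X : R -> T -> R) : Prop :=
  forall t, 0 <= t -> measurable_wrt (F t) (X t).

Definition cadlag (X : R -> T -> R) : Prop :=
  forall w, (forall t, 0 <= t -> X s w @[s --> t^'+] --> X t w) /\
            (forall t, 0 < t -> cvg (X s w @[s --> t^'-])).

(* Martingales are cadlag by convention; adaptedness and integrability are
   contained in is_condexp (take s = t). *)
Definition martingale (F : R -> set (set T)) (M : R -> T -> R) : Prop :=
  cadlag M /\
  forall s t, 0 <= s -> s <= t -> is_condexp (F s) (M t) (M s).

Definition L2_bounded (M : R -> T -> R) : Prop :=
  (ereal_sup [set \int[P]_w ((M t w) ^+ 2)%:E | t in [set t | (0 <= t)%R]]
     < +oo)%E.

(* M_oo, the almost sure limit of M_t at infinity; lim is arbitrary on the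
   (null, for the martingales below) set of w where M_t w diverges. *)
Definition terminal (M : R -> T -> R) : T -> R :=
  fun w => lim (M t w @[t --> +oo%R]).

Definition H1 (F : R -> set (set T)) (M : R -> T -> R) : Prop :=
  martingale F M /\
  (\int[P]_w ereal_sup [set `|M t w|%:E | t in [set t | (0 <= t)%R]] < +oo)%E.

Definition stopping_time (F : R -> set (set T)) (S : T -> \bar R) : Prop :=
  (forall w, (0 <= S w)%E) /\
  forall t, 0 <= t -> F t [set w | (S w <= t%:E)%E].

Definition time_domain : set (R * T) := [set p | 0 <= p.1].

Definition optional_sigma_algebra (F : R -> set (set T)) : set (set (R * T)) :=
  <<s time_domain,
      \bigcup_(X in [set X | adapted F X /\ cadlag X])
        preimage_set_system time_domain (fun p => X p.1 p.2) borel >>.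

Definition optional_process (F : R -> set (set T)) (z : R -> T -> R) : Prop :=
  preimage_set_system time_domain (fun p => z p.1 p.2) borel
    `<=` optional_sigma_algebra F.

(* z_L; on {L = oo}, a null set for the times considered here, fine L = 0. *)
Definition at_time (z : R -> T -> R) (L : T -> \bar R) : T -> R :=
  fun w => z (fine (L w)) w.

Definition sigma_at (F : R -> set (set T)) (L : T -> \bar R) : set (set T) :=
  <<s \bigcup_(z in optional_process F)
        preimage_set_system setT (at_time z L) borel >>.

(* maxe 0 because the supremum is taken in [0, +oo], where sup set0 = 0,
   whereas ereal_sup set0 = -oo. *)
Definition end_of (Gam : set (R * T)) : T -> \bar R :=
  fun w => maxe 0%E (ereal_sup [set t%:E | t in [set t | Gam (t, w)]]).

Definition honest_time (F : R -> set (set T)) (L : T -> \bar R) : Prop :=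
  [/\ measurable_fun [set: T] L,
      exists2 Gam, optional_sigma_algebra F Gam & L = end_of Gam,
      P [set w | L w = 0%E] = 0%E &
      P [set w | L w = +oo%E] = 0%E].

Definition avoids_stopping_times (F : R -> set (set T)) (L : T -> \bar R) :
    Prop :=
  forall S, stopping_time F S -> P [set w | L w = S w] = 0%E.

Definition S2 (F : R -> set (set T)) (L : T -> \bar R) (M : R -> T -> R) :
    Prop :=
  H1 F M /\ is_condexp (sigma_at F L) (terminal M) (at_time M L).

End general_theory.

(* Main.v *)
Require Import Defs.
From HB Require Import structures.
From mathcomp Require Import all_boot all_order all_algebra.
From mathcomp Require Import all_classical all_reals all_analysis.
From mathcomp Require Import measurable_realfun ring lra.
Import Order.TTheory GRing.Theory Num.Theory.
Import numFieldNormedType.Exports.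
Local Open Scope classical_set_scope.
Local Open Scope ring_scope.

(** Write N for the martingale M - K, K being a cadlag version of E[ML | F_t],
and N_oo for its limit at infinity. The limit satisfies E[N_oo | F_oo] =
E[M_oo - ML | F_oo], and F_L is contained in F_oo, so that
E[N_oo | F_L] = 0. Everything therefore comes down to N_L = 0 almost surely
([vanishes_at_end]).

Let Gam be an optional set ending at L, and let d_q be the first time after q
at which Gam is visited. It is a stopping time; it is finite exactly when L > q,
and then d_q <= L, which condition (A) improves to d_q < L. If A is an event of
F_(d_q+), then the intersection of A and {d_q < L} belongs to F_L
([sigma_at_after]), so optional stopping gives
E[N_(d_q) ; A, d_q < oo] = E[N_oo ; A, d_q < L] = 0, and N vanishes at d_q on
{d_q < oo} ([vanishes_at_debut]). When q increases to L through the rationals,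
d_q increases to L while staying strictly below it, and the left limit of N at L
is 0. If moreover |N_L| > e, then for q close enough to L the time L is the
first one after q at which |N| > e. This is again a stopping time, so (A) makes
the event negligible.

Two bodies of theory support this. That d_q is a stopping time is the debut
theorem, a consequence of the measurable projection theorem
([measurable_projection]), which is proved here by Choquet's capacitability of
Souslin sets. The convergence of N, its closure by N_oo and the integrability of
sup |N| use that N is bounded in L2, through three inequalities: Jensen's
inequality for squares on an event of the conditioning sigma-algebra
([condexp_sq_le]), the parallelogram identity, which bounds the increments of a
martingale by the growth of its second moment ([condexp_sqB_le]), and the
maximal inequality ([L2_maximal_inequality]). *)

Set Implicit Arguments.
Unset Strict Implicit.
Unset Printing Implicit Defensive.

(** * Souslin sets and capacitability *)

Section souslin.
Context (R : realType) (T : pointedType) (G : set (set T)).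
Hypothesis sG : sigma_algebra setT G.
Implicit Types (K C : set (R * T)).

Let G0 : G set0. Proof. by case: sG. Qed.
Let GC A : G A -> G (~` A).
Proof. by case: sG => _ + _ => /[apply]; rewrite setTD. Qed.
Let GU A B : G A -> G B -> G (A `|` B).
Proof.
move=> GA GB; case: sG => _ _ /(_ (fun n => if n is 0%N then A else B)).
rewrite (_ : \bigcup_k _ = A `|` B); first by apply; case.
apply/seteqP; split => x; first by case=> -[|n] _; [left|right].
by case; [exists 0%N|exists 1%N].
Qed.
Let GI A B : G A -> G B -> G (A `&` B).
Proof. by move=> GA GB; rewrite -(setCK (_ `&` _)) setCI; apply/GC/GU; exact: GC. Qed.

(** Stable under finite unions and intersections, with projections in [G]. The
factor in [R] is only closed, so that the whole space is in the paving;
compactness enters later, when the time is restricted to a segment. *)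
Inductive paving : set (R * T) -> Prop :=
| paving0 : paving set0
| pavingX (F : set R) A : closed F -> G A -> paving (F `*` A)
| pavingU K1 K2 : paving K1 -> paving K2 -> paving (K1 `|` K2).

Lemma pavingT : paving setT.
Proof. by rewrite -setXTT; apply: pavingX; [exact: closedT|rewrite -setC0; exact: GC]. Qed.

Lemma pavingI K1 K2 : paving K1 -> paving K2 -> paving (K1 `&` K2).
Proof.
move=> p1; elim: p1 K2 => [K2|F A cF GA K2|L1 L2 _ IH1 _ IH2 K2 p2].
- by rewrite set0I => _; exact: paving0.
- elim=> [|F' A' cF' GA'|L1 L2 _ IH1 _ IH2].
  + by rewrite setI0; exact: paving0.
  + by rewrite -setXI; apply: pavingX; [exact: closedI|exact: GI].
  + by rewrite setIUr; exact: pavingU.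
- by rewrite setIUl; apply: pavingU; [exact: IH1|exact: IH2].
Qed.

Lemma paving_section_closed K : paving K -> forall w, closed [set t | K (t, w)].
Proof.
elim=> [w|F A cF GA w|K1 K2 _ c1 _ c2 w].
- exact: closed0.
- have [Aw|nAw] := pselect (A w).
    by rewrite (_ : mkset _ = F)//; apply/seteqP; split=> t //= [].
  by rewrite (_ : mkset _ = set0); [exact: closed0|apply/seteqP; split=> t //= []].
- exact: (closedU (c1 w) (c2 w)).
Qed.

Lemma paving_proj K (I : set R) : paving K -> G (snd @` (K `&` (I `*` setT))).
Proof.
elim=> [|F A cF GA|K1 K2 _ c1 _ c2].
- by rewrite set0I image_set0.
- have [[t [Ft It]]|nFI] := pselect (exists t, F t /\ I t).
    rewrite (_ : _ @` _ = A)//; apply/seteqP; split=> [w [[s u] [/= [_ Au] _] <-//]|w Aw].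
    by exists (t, w).
  rewrite (_ : _ @` _ = set0)//; apply/seteqP; split=> [w [[s u] [/= [Fs _] [Is _] _]]|//].
  by apply: nFI; exists s.
- by rewrite setIUl image_setU; exact: GU.
Qed.

Definition prefix_eq n (s t : nat -> nat) := forall i, (i < n)%N -> t i = s i.

Definition local_at (K : (nat -> nat) -> set (R * T)) s m :=
  forall t, prefix_eq m s t -> K t = K s.

(** The Souslin operation, the branches being all the sequences [s]. Each
condition looks at finitely many coordinates of the branch, but their number may
depend on the branch, which is what makes countable unions immediate. *)
Definition analytic C := exists K : nat -> (nat -> nat) -> set (R * T),
  [/\ forall n s, paving (K n s), forall n s, exists m, local_at (K n) s m &
      C = [set x | exists s, forall n, K n s x]].

Lemma paving_analytic K : paving K -> analytic K.
Proof.
move=> pK; exists (fun=> fun=> K); split=> // [n s|]; first by exists 0%N.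
by apply/seteqP; split=> x; [move=> Kx; exists id|case=> s /(_ 0%N)].
Qed.

(** The first coordinate of the branch selects a set of the family. *)
Lemma analytic_bigcup (C : nat -> set (R * T)) :
  (forall i, analytic (C i)) -> analytic (\bigcup_i C i).
Proof.
move=> /choice[K aK].
exists (fun n s => K (s 0%N) n (fun k => s k.+1)); split.
- by move=> n s; case: (aK (s 0%N)).
- move=> n s; case: (aK (s 0%N)) => _ /(_ n (fun k => s k.+1))[m Hm] _.
  exists m.+1 => t ts; rewrite ts//; apply: Hm => i im; exact: ts.
- apply/seteqP; split=> x.
    case=> i _; case: (aK i) => _ _ -> [s Ks].
    by exists (fun k => if k is k'.+1 then s k' else i).
  case=> s Ks; exists (s 0%N) => //; case: (aK (s 0%N)) => _ _ ->.
  by exists (fun k => s k.+1).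
Qed.

(** One branch codes a branch for each set of the family, by a pairing of
natural numbers. *)
Lemma analytic_bigcap (C : nat -> set (R * T)) :
  (forall i, analytic (C i)) -> analytic (\bigcap_i C i).
Proof.
move=> /choice[K aK].
pose sub (s : nat -> nat) (i k : nat) : nat := s (pickle (i, k)).
exists (fun n s => if @unpickle (nat * nat)%type n is Some (i, j) then K i j (sub s i) else setT).
split.
- move=> n s; case: unpickle => [[i j]|]; last exact: pavingT.
  by case: (aK i).
- move=> n s; case: unpickle => [[i j]|]; last by exists 0%N.
  case: (aK i) => _ /(_ j (sub s i))[m Hm] _.
  exists (\sum_(k < m) (pickle (i, nat_of_ord k)).+1)%N => t ts.
  apply: Hm => k km; apply: ts.
  by rewrite (bigD1 (Ordinal km))//= addSn ltnS leq_addr.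
- apply/seteqP; split=> x.
    move=> Cx.
    have /choice[S HS] : forall i, exists s, forall n, K i n s x.
      by move=> i; have := Cx i Logic.I; case: (aK i) => _ _ ->.
    exists (fun n => if @unpickle (nat * nat)%type n is Some (i, k) then S i k else 0%N) => n.
    case: unpickle => [[i j]|//].
    rewrite (_ : sub _ i = S i)//; apply/funext => k.
    by rewrite /sub pickleK.
  case=> s Ks i _; case: (aK i) => _ _ ->.
  exists (sub s i) => n.
  by have := Ks (pickle (i, n)); rewrite pickleK.
Qed.

Definition upd (s : nat -> nat) n v := fun i => if i == n then v else s i.

Lemma updE s n : upd s n (s n) = s.
Proof. by apply/funext => i; rewrite /upd; case: eqP => // ->. Qed.

Lemma prefix_eqS n s t : prefix_eq n s t -> prefix_eq n.+1 (upd s n (t n)) t.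
Proof.
move=> st i; rewrite ltnS /upd; case: eqP => [->//|/eqP ni].
by rewrite leq_eqVlt (negbTE ni)/= => /st.
Qed.

(** Dependent choice for properties of finite prefixes: the branch is the limit
of the prefixes chosen so far, and locality carries the property from the
n-th prefix to the branch itself. *)
Lemma branch_choice (Q : nat -> (nat -> nat) -> Prop) :
  (forall n s t, prefix_eq n s t -> Q n s -> Q n t) -> (exists s, Q 0%N s) ->
  (forall n s, Q n s -> exists v, Q n.+1 (upd s n v)) ->
  exists s, forall n, Q n s.
Proof.
move=> Qloc [s0 Q0] step.
have /choice[v Hv] : forall mp : nat * (nat -> nat), exists v,
    Q mp.1 mp.2 -> Q mp.1.+1 (upd mp.2 mp.1 v).
  move=> [m p]; have [/step[v Hv]|] := pselect (Q m p); first by exists v.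
  by exists 0%N.
pose p := fix p n := if n is m.+1 then upd (p m) m (v (m, p m)) else s0.
have Qp n : Q n (p n) by elim: n => [|n IH] //=; exact: (Hv (n, p n) IH).
have pS m n : (m < n)%N -> p n m = p m.+1 m.
  elim: n => // n IH; rewrite ltnS leq_eqVlt => /predU1P[->//|mn].
  by rewrite -IH//= {1}/upd ltn_eqF.
exists (fun m => p m.+1 m) => n; apply: Qloc (Qp n) => i iN.
by rewrite pS.
Qed.

(** The union runs over the finitely many prefixes of length [n] bounded by
[h]. *)
Lemma paving_bounded_union (h : nat -> nat) n (K : (nat -> nat) -> set (R * T)) :
  (forall s, paving (K s)) -> (forall s, local_at K s n) ->
  paving [set x | exists s, (forall i, (s i <= h i)%N) /\ K s x].
Proof.
elim: n K => [|n IH] K pK lK.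
  rewrite (_ : mkset _ = K h)//; apply/seteqP; split=> [x [s [_]]|x Kx].
    by rewrite (lK h).
  by exists h.
pose L v := [set x | exists s, (forall i, (s i <= h i)%N) /\ K (upd s n v) x].
have pL v : paving (L v).
  apply: IH => [s//|s t ts]; apply: lK => i; rewrite ltnS /upd.
  by case: eqP => // /eqP ni; rewrite leq_eqVlt (negbTE ni)/= => /ts.
rewrite (_ : mkset _ = \big[setU/set0]_(v < (h n).+1) L v).
  elim: (h n).+1 => [|k IHk]; first by rewrite big_ord0; exact: paving0.
  by rewrite big_ord_recr; exact: pavingU.
rewrite -bigcup_mkord; apply/seteqP; split=> [x [s [sh Ks]]|x [v /= vh [s [sh Ks]]]].
  exists (s n) => /=; first by rewrite ltnS.
  by exists s; split => //; rewrite updE.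
exists (upd s n v); split => // i; rewrite /upd.
by case: eqP => // ->; rewrite -ltnS.
Qed.

(** Koenig's lemma in the finitely branching tree of the sequences bounded by
[h]. *)
Lemma bounded_branch (h : nat -> nat) (Q : nat -> (nat -> nat) -> Prop) :
  (forall n s t, prefix_eq n s t -> Q n s -> Q n t) ->
  (forall n s, Q n.+1 s -> Q n s) ->
  (forall n, exists s, (forall i, (s i <= h i)%N) /\ Q n s) ->
  exists s, (forall i, (s i <= h i)%N) /\ forall n, Q n s.
Proof.
move=> Qloc Qdec Qex.
have Qdecn m n s : (m <= n)%N -> Q n s -> Q m s.
  move=> /subnK <-; elim: (n - m)%N => [//|k IH].
  by rewrite addSn => /Qdec.
pose ext m p := forall n, exists s,
  [/\ forall i, (s i <= h i)%N, prefix_eq m p s & Q n s].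
have [p pE] : exists p, forall m, ext m p /\ forall i, (i < m)%N -> (p i <= h i)%N.
  apply: branch_choice => [m s t st [es sh]||m p [ep ph]].
  - split=> [n|i im]; last by rewrite st//; exact: sh.
    have [u [uh su Qu]] := es n; exists u; split=> // i im.
    by rewrite su// st.
  - exists (fun=> 0%N); split=> [n|//].
    by have [s [sh Qs]] := Qex n; exists s.
  suff [v [vh ev]] : exists v, (v <= h m)%N /\ ext m.+1 (upd p m v).
    exists v; split=> // i; rewrite ltnS /upd; case: eqP => [->//|/eqP im].
    by rewrite leq_eqVlt (negbTE im)/= => /ph.
  (* if each value v <= h m failed at some stage N v, none would survive the
     stage that sums the N v *)
  apply: contrapT => /forallNP nv.
  have /choice[N HN] : forall v, exists n, (v <= h m)%N -> forall s,
      (forall i, (s i <= h i)%N) -> prefix_eq m.+1 (upd p m v) s -> ~ Q n s.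
    move=> v; have := nv v; case: (leqP v (h m)) => vh; last by exists 0%N.
    move=> /not_andP[//|] /existsNP[n Hn]; exists n => _ s sh sp Qs.
    by apply: Hn; exists s.
  have [s [sh sp Qs]] := ep (\sum_(v < (h m).+1) N v)%N.
  apply: (HN (s m) (sh m) s sh); first exact: prefix_eqS.
  apply: Qdecn Qs.
  have sm : (s m < (h m).+1)%N by rewrite ltnS.
  by rewrite (bigD1 (Ordinal sm))//= leq_addr.
exists p; split=> [i|n]; first by case: (pE i.+1) => _; apply.
have [/(_ n)[s [_ ps Qs]] _] := pE n.
by apply: Qloc Qs => i iN; rewrite ps.
Qed.

Section capacitability.
Variable big : set (R * T) -> Prop.
Hypothesis big_sub : forall A B, A `<=` B -> big A -> big B.
Hypothesis big_nd : forall A : nat -> set (R * T),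
  {homo A : m n / (m <= n)%N >-> m `<=` n} -> big (\bigcup_n A n) ->
  exists n, big (A n).

(** Choquet's theorem, where [big] stands for a capacity above a given level.
Continuity along increasing unions bounds the coordinates of the branches, one
after the other, without losing bigness. The branches bounded by [h] form a
compact set: testing only what the first [n] coordinates decide gives decreasing
sets of the paving whose intersection still lies in [C]. *)
Lemma capacitability C : analytic C -> big C ->
  exists B : nat -> set (R * T),
    [/\ forall n, paving (B n), forall n, B n.+1 `<=` B n,
        \bigcap_n B n `<=` C & forall n, big (B n)].
Proof.
move=> [K [pK lK CE]] bC.
pose Cb n (h : nat -> nat) :=
  [set x | exists s, (forall i, (i < n)%N -> (s i <= h i)%N) /\ forall j, K j s x].
have CbE n h h' : prefix_eq n h h' -> Cb n h `<=` Cb n h'.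
  by move=> hh x [s [sh Ks]]; exists s; split=> // i iN; rewrite hh//; exact: sh.
have step n h : big (Cb n h) -> exists v, big (Cb n.+1 (upd h n v)).
  move=> bnh; apply: big_nd.
    move=> v v' vv' x [s [sh Ks]]; exists s; split=> // i iN.
    by apply: leq_trans (sh i iN) _; rewrite /upd; case: eqP.
  apply: big_sub bnh => x [s [sh Ks]]; exists (s n) => //; exists s; split=> // i.
  rewrite ltnS /upd; case: eqP => [->//|/eqP ni].
  by rewrite leq_eqVlt (negbTE ni)/= => /sh.
have [h bh] : exists h, forall n, big (Cb n h).
  apply: branch_choice => [n h h' /CbE|//|//]; first exact: big_sub.
  by exists id; apply: big_sub bC => x; rewrite CE => -[s Ks]; exists s.
(* the condition K j once the first n coordinates of the branch decide it,
   and no condition before *)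
pose Kt n j s := if `[< local_at (K j) s n >] then K j s else setT.
have locE n j s t : prefix_eq n s t ->
    local_at (K j) s n -> local_at (K j) t n.
  move=> ts ls u ut; rewrite (ls t)//; apply: ls => i iN; by rewrite ut// ts.
have KtE n j s t : prefix_eq n s t -> Kt n j t = Kt n j s.
  move=> ts; rewrite /Kt; case: asboolP => [lt|nlt]; case: asboolP => [ls|nls] //.
  - exact: ls.
  - by exfalso; apply: nls; apply: locE lt => i iN; rewrite ts.
  - by exfalso; apply: nlt; exact: locE ls.
have Ktle n j s : Kt n.+1 j s `<=` Kt n j s.
  rewrite /Kt; case: asboolP => [_|nl]; case: asboolP => [ls|_]//.
  by exfalso; apply: nl => t ts; apply: ls => i iN; apply: ts; exact: ltnW.
pose Q n s x := forall j, (j < n)%N -> Kt n j s x.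
exists (fun n => [set x | exists s, (forall i, (s i <= h i)%N) /\ Q n s x]); split.
- move=> n; apply: (@paving_bounded_union _ n).
    move=> s; rewrite /Q.
    have : forall m, paving [set x | forall j, (j < m)%N -> Kt n j s x].
      elim=> [|m IH]; first by rewrite (_ : mkset _ = setT); [exact: pavingT|apply/seteqP].
      rewrite (_ : mkset _ = [set x | forall j, (j < m)%N -> Kt n j s x] `&` Kt n m s).
        by apply: pavingI => //; rewrite /Kt; case: asboolP => _ //; exact: pavingT.
      apply/seteqP; split=> x /=.
        by move=> H; split=> [j jm|]; apply: H => //; exact: ltnW.
      by case=> H1 H2 j; rewrite ltnS leq_eqVlt => /predU1P[->//|]; exact: H1.
    exact.
  move=> s t ts; apply/seteqP; split=> x H j jn; have := H j jn; by rewrite (KtE _ _ _ _ ts).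
- move=> n x [s [sh Qs]]; exists s; split => // j jn.
  by apply: Ktle; apply: Qs; exact: ltnW.
- move=> x Bx; rewrite CE.
  have [s [sh Qs]] : exists s, (forall i, (s i <= h i)%N) /\ forall n, Q n s x.
    apply: bounded_branch => [n s t ts Qs j jn|n s Qs j jn|n].
    - by rewrite (KtE _ _ _ _ ts); exact: Qs.
    - by apply: Ktle; apply: Qs; exact: ltnW.
    - exact: Bx n Logic.I.
  exists s => j; have [m lm] := lK j s.
  have := Qs (maxn m j.+1) j; rewrite leq_max ltnSn orbT => /(_ isT).
  rewrite /Kt; case: asboolP => // nl; exfalso; apply: nl => t ts; apply: lm => i im.
  by apply: ts; rewrite leq_max im.
- move=> n; apply: big_sub (bh n) => x [s [sh Ks]].
  pose s' i := if (i < n)%N then s i else 0%N.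
  exists s'; split=> [i|j jn].
    by rewrite /s'; case: ifPn => // iN; exact: sh.
  rewrite /Kt; case: asboolP => // ls'.
  by rewrite -(ls' s)// => i iN; rewrite /s' iN.
Qed.

End capacitability.
End souslin.

(** * The measurable projection theorem *)

Section projection.
Context (R : realType) (d : measure_display) (T : measurableType d)
        (P : probability T R) (G : set (set T)).
Hypothesis sG : sigma_algebra setT G.
Hypothesis Gmeas : G `<=` measurable.
Hypothesis Gnull : forall N, P.-negligible N -> G N.

Let GC A : G A -> G (~` A).
Proof. by case: sG => _ + _ => /[apply]; rewrite setTD. Qed.

Let pr (I : set R) (A : set (R * T)) := snd @` (A `&` (I `*` setT)).

(** The outer probability of the projection of [A] over [I] exceeds [al]. *)
Let big I (al : \bar R) A := forall H : set T, measurable H -> pr I A `<=` H -> (al < P H)%E.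

(** Covers [H n] of the projections are made increasing by intersecting the
later ones. *)
Lemma big_nd I al (A : nat -> set (R * T)) :
  {homo A : m n / (m <= n)%N >-> m `<=` n} -> big I al (\bigcup_n A n) ->
  exists n, big I al (A n).
Proof.
move=> ndA bA; apply: contrapT => /forallNP nb.
have /choice[H HP] : forall n, exists H : set T,
    [/\ measurable H, pr I (A n) `<=` H & (P H <= al)%E].
  move=> n; have /existsNP[H /not_implyP[mH /not_implyP[AH /negP]]] := nb n.
  by rewrite -leNgt => HH; exists H.
have mH n : measurable (H n) by case: (HP n).
pose H' n := \bigcap_(m in [set m | (n <= m)%N]) H m.
have mH' n : measurable (H' n) by exact: bigcap_measurableType.
have H'al n : (P (H' n) <= al)%E.
  case: (HP n) => _ _; apply: le_trans; apply: le_measure; rewrite ?inE//.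
  by apply: bigcap_inf => /=.
have mU : measurable (\bigcup_n H' n) by exact: bigcupT_measurable.
have ndH' : nondecreasing_seq H'.
  by move=> m n mn; apply/subsetPset => x Hx k /= nk; apply: Hx => /=; exact: leq_trans nk.
have cP : P \o H' @ \oo --> P (\bigcup_n H' n) := nondecreasing_cvg_mu mH' mU ndH'.
have : (P (\bigcup_n H' n) <= al)%E.
  rewrite -(cvg_lim _ cP)//; apply: lime_le; first by apply/cvg_ex; eexists; exact: cP.
  exact: nearW.
rewrite leNgt => /negP; apply; apply: bA => // w [[t u] [[n _ An] It] <-].
exists n => // m /= nm; case: (HP m) => _ + _; apply.
by exists (t, u) => //; split => //; exact: ndA An.
Qed.

Lemma big_sub I al A B : A `<=` B -> big I al A -> big I al B.
Proof.
move=> AB bA H mH BH; apply: bA => // w [x [Ax Ix] <-]; apply: BH.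
by exists x => //; split=> //; exact: AB.
Qed.

(** A decreasing sequence of nonempty compact sections has a common point. *)
Lemma pr_bigcap (a b : R) (B : nat -> set (R * T)) :
  (forall n w, closed [set t | B n (t, w)]) -> (forall n, B n.+1 `<=` B n) ->
  \bigcap_n pr `[a, b] (B n) `<=` pr `[a, b] (\bigcap_n B n).
Proof.
move=> cB dB w Bw.
have dBn m n : (m <= n)%N -> B n `<=` B m.
  move=> /subnK <-; elim: (n - m)%N => [//|k IH].
  by rewrite addSn; apply: subset_trans IH.
have := @segment_compact R a b; rewrite compact_In0.
move=> /(_ _ setT (fun n => `[a, b] `&` [set t | B n (t, w)])) []; last first.
- move=> t Ht; exists (t, w) => //; split=> [n _|/=]; first by have [] := Ht n Logic.I.
  by split => //; have [] := Ht 0%N Logic.I.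
- move=> D _; have [[t u] [Bt [It _]] /= uw] := Bw (\max_(i <- finmap.enum_fset D) i)%N Logic.I.
  rewrite uw in Bt; exists t => n /= nD; split => //=; apply: dBn Bt.
  exact: (@leq_bigmax_seq _ _ xpredT id).
- by exists (fun n => [set t | B n (t, w)]).
Qed.

Let fP A : measurable A -> P A \is a fin_num.
Proof. by move=> mA; exact: fin_num_measure. Qed.

Lemma analytic_proj_inner a b (C : set (R * T)) al : analytic G C ->
  big `[a, b] al C -> exists A, [/\ G A, A `<=` pr `[a, b] C & (al <= P A)%E].
Proof.
move=> aC bC; have [B [pB dB BC bB]] := capacitability sG (@big_sub _ _) (@big_nd _ _) aC bC.
have GB n : G (pr `[a, b] (B n)) by exact: paving_proj.
exists (\bigcap_n pr `[a, b] (B n)).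
have Gcap : G (\bigcap_n pr `[a, b] (B n)).
  rewrite -(setCK (\bigcap_n _)) setC_bigcap; apply: GC.
  by case: sG => _ _; apply => n; exact: GC.
split => //.
- apply: subset_trans (pr_bigcap _ dB) _.
    by move=> n; exact: paving_section_closed.
  by move=> w [x [Bx Ix] <-]; exists x => //; split=> //; exact: BC.
- have cP : P \o (fun n => pr `[a, b] (B n)) @ \oo --> P (\bigcap_n pr `[a, b] (B n)).
    apply: nonincreasing_cvg_mu.
    + by rewrite ltey_eq fP//; exact: Gmeas.
    + by move=> n; exact: Gmeas.
    + exact: Gmeas.
    + move=> m n /subnK <-; elim: (n - m)%N => [//|k IH].
      rewrite addSn; apply: le_trans IH; apply/subsetPset => w [x [Bx Ix] <-].
      by exists x => //; split=> //; exact: dB.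
  rewrite -(cvg_lim _ cP)//; apply: lime_ge; first by apply/cvg_ex; eexists; exact: cP.
  apply: nearW => n /=; exact/ltW/(bB n _ (Gmeas (GB n))).
Qed.

(** The projection is caught between sets of [G] inside, given by
capacitability, and measurable sets outside, given by the definition of the outer
probability. The gap is negligible, hence in [G]. *)
Lemma analytic_proj_segment a b (C : set (R * T)) : analytic G C ->
  G (pr `[a, b] C).
Proof.
move=> aC; set D := pr _ _.
pose U := [set P H | H in [set H : set T | measurable H /\ D `<=` H]].
have U0 : (0 <= ereal_inf U)%E.
  by apply: le_ereal_inf_tmp => _ [H _ <-]; exact: measure_ge0.
have U1 : (ereal_inf U <= 1)%E.
  by apply: ereal_inf_lbound; exists setT => //; exact: probability_setT.
have fU : ereal_inf U \is a fin_num.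
  by rewrite ge0_fin_numE//; apply: le_lt_trans U1 _; rewrite ltry.
have /choice[AH HAH] : forall k : nat, exists AH : set T * set T,
    [/\ G AH.1, measurable AH.2, AH.1 `<=` D, D `<=` AH.2 &
    (P (AH.2 `\` AH.1) <= (2 * k.+1%:R^-1)%:E)%E].
  move=> k; have e0 : 0 < k.+1%:R^-1 :> R by rewrite invr_gt0.
  have [_ [H [mH DH] <-] HU] := lb_ereal_inf_adherent e0 fU.
  have [A [GA AD UA]] : exists A, [/\ G A, A `<=` D & (ereal_inf U - (k.+1%:R^-1)%:E <= P A)%E].
    apply: analytic_proj_inner => // H' mH' DH'.
    apply: (@lt_le_trans _ _ (ereal_inf U)); last by apply: ereal_inf_lbound; exists H'.
    by rewrite lteBlDr// lteDl.
  exists (A, H); split => //=.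
  have mA := Gmeas GA.
  have -> : (P (H `\` A) = P H - P A)%E.
    rewrite measureD//; last by rewrite ltey_eq fP.
    by rewrite (_ : H `&` A = A)//; apply/setIidPr; exact: subset_trans DH.
  move: HU UA; rewrite -(fineK (fP mH)) -(fineK (fP mA)) -(fineK fU).
  by rewrite -!EFinD lte_fin !lee_fin; clear;
    move: (fine (P H)) (fine (P A)) (fine _) (k.+1%:R^-1) => x y z e; lra.
pose A := \bigcup_k (AH k).1.
have GA : G A by case: sG => _ _; apply => k; case: (HAH k).
have AD : A `<=` D by apply: bigcup_sub => k _; case: (HAH k).
suff nDA : P.-negligible (D `\` A).
  rewrite -(setDUK AD); case: sG => _ _ /(_ (fun n => if n is 0%N then A else (D `\` A))).
  rewrite (_ : \bigcup_k _ = A `|` (D `\` A)).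
    by apply => -[|n] //; exact: Gnull.
  apply/seteqP; split => x; first by case=> -[|n] _; [left|right].
  by case; [exists 0%N|exists 1%N].
pose H := \bigcap_k (AH k).2.
have mH : measurable H by apply: bigcapT_measurable => k; case: (HAH k).
have mA : measurable A by exact: Gmeas.
have DH : D `<=` H by move=> x Dx k _; case: (HAH k) => _ _ _ + _; exact.
exists (H `\` A); split; [exact: measurableD| |exact: setSD].
apply/eqP; rewrite eq_le measure_ge0 andbT; apply/lee_addgt0Pr => e e0.
rewrite add0e; pose k := Num.trunc (2 * e^-1).
apply: (@le_trans _ _ (2 * k.+1%:R^-1)%:E).
  case: (HAH k) => Gk mHk _ _; apply: le_trans; apply: le_measure; rewrite ?inE.
  - exact: measurableD.
  - by apply: measurableD => //; exact: Gmeas.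
  - by move=> x [Hx nAx]; split; [exact: Hx|move=> Akx; apply: nAx; exists k].
rewrite lee_fin ler_pdivrMr// mulrC -ler_pdivrMr//; apply: ltW; exact: truncnS_gt.
Qed.

Let bianalytic (C : set (R * T)) := analytic G C /\ analytic G (~` C).

Let bianalytic_sigma : sigma_algebra setT bianalytic.
Proof.
split.
- split; first exact/paving_analytic/paving0.
  by rewrite setC0; apply/paving_analytic; exact: pavingT.
- by move=> A [a1 a2]; rewrite setTD; split=> //; rewrite setCK.
- move=> A Ab; split; first by apply: analytic_bigcup => i; case: (Ab i).
  by rewrite setC_bigcup; apply: analytic_bigcap => // i; case: (Ab i).
Qed.

(** Complements of analytic sets need not be analytic, but the analytic sets
with analytic complement form a sigma-algebra, and it contains the
rectangles. *)
Lemma measurable_analytic (C : set (R * T)) :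
  measurable (C : set (R * g_sigma_algebraType G)) -> analytic G C.
Proof.
suff : (measurable : set (set (R * g_sigma_algebraType G))) `<=` bianalytic.
  by move=> /[apply] -[].
have GT : G setT by rewrite -setC0; apply: GC; case: sG.
have aX F A : closed F -> G A -> analytic G (F `*` A).
  by move=> cF GA; apply/paving_analytic; exact: pavingX.
apply: smallest_sub => //; rewrite subUset; split.
- move=> _ [B mB <-]; rewrite setTI.
  pose S := [set B : set R | bianalytic (fst @^-1` B)].
  suff : (measurable : set (set R)) `<=` S by apply.
  have -> : (measurable : set (set R)) = <<s @RGenOInfty.G R >> by exact: RGenOInfty.measurableE.
  apply: smallest_sub.
    split => [|A|A SA]; rewrite /S/=.
    + by rewrite preimage_set0; case: bianalytic_sigma.
    + by rewrite setTD -preimage_setC; case: bianalytic_sigma => _ + _ => /[apply]; rewrite setTD.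
    + by rewrite preimage_bigcup; case: bianalytic_sigma => _ _; apply.
  move=> _ [x ->]; split.
    rewrite itvoyEbigcup preimage_bigcup; apply: analytic_bigcup => i.
    by rewrite -[X in analytic _ X]setXT; apply: aX => //; exact: rray_closed.
  rewrite preimage_setC setCitvr -[X in analytic _ X]setXT; apply: aX => //; exact: lray_closed.
- move=> _ [B mB <-]; rewrite setTI.
  have GB : G B by rewrite -(sigma_algebra_id sG).
  split; first by rewrite -[X in analytic _ X]setTX; apply: aX.
  by rewrite preimage_setC -[X in analytic _ X]setTX; apply: aX => //; exact: GC.
Qed.

Theorem measurable_projection (C : set (R * T)) :
  measurable (C : set (R * g_sigma_algebraType G)) -> G (snd @` C).
Proof.
move=> /measurable_analytic aC.
rewrite (_ : _ @` _ = \bigcup_n pr `[- n%:R, n%:R] C).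
  by case: sG => _ _; apply => n; exact: analytic_proj_segment.
apply/seteqP; split=> [w [[t u] /= Ct <-]|w [n _ [x [Cx _] <-]]]; last by exists x.
exists (Num.trunc `|t|).+1 => //; exists (t, u) => //; split => //=; split => //=.
by rewrite in_itv/= -ler_norml; apply: ltW; exact: truncnS_gt.
Qed.

End projection.

(** * Progressive measurability *)

Lemma g_measurableE (T : pointedType) (G : set (set T)) : sigma_algebra setT G ->
  (measurable : set (set (g_sigma_algebraType G))) = G.
Proof. exact: sigma_algebra_id. Qed.

Lemma measurable_wrtP (R : realType) d (T : measurableType d) (G : set (set T)) (X : T -> R) :
  sigma_algebra setT G ->
  measurable_wrt G X <-> measurable_fun setT (X : g_sigma_algebraType G -> R).
Proof.
move=> sG; split=> [mX _ B mB|mX _ [B mB <-]].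
  by rewrite g_measurableE//; apply: mX; exists B.
by have := mX measurableT B mB; rewrite g_measurableE.
Qed.

Section right_continuous.
Context (R : realType) d (S : measurableType d) (X : R -> S -> R).
Hypothesis rcX : forall (w : S) (t : R), 0 <= t -> X s w @[s --> t^'+] --> X t w.

(** A process read on a grid of times is measurable because the grid is
countable. *)
Lemma measurable_grid (phi : nat -> R) (c : R -> R) :
  (forall k, measurable_fun setT (X (phi k))) -> measurable_fun setT c ->
  (forall s, 0 <= c s) ->
  measurable_fun setT (fun p : R * S => X (phi (Num.trunc (c p.1))) p.2).
Proof.
move=> mX mc c0 _ B mB; rewrite setTI.
rewrite (_ : _ @^-1` _ = \bigcup_k ((c @^-1` `[k%:R, k.+1%:R[) `*` (X (phi k) @^-1` B))).
  apply: bigcupT_measurable => k; apply: measurableX.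
    by rewrite -[X in measurable X]setTI; exact: mc.
  by rewrite -[X in measurable X]setTI; exact: mX.
apply/seteqP; split=> [[s w] /= Bx|[s w] [k _ [/= cs Bx]]].
  exists (Num.trunc (c s)) => //; split => //=.
  by rewrite in_itv/=; exact: truncn_itv.
by rewrite (_ : Num.trunc _ = k)//; apply: truncn_def; move: cs; rewrite in_itv.
Qed.

(** Times are clamped between 0 and [t], then moved to the right on the grid of mesh
[1/(n+1)] and capped at [t]: only values up to time [t] are used, and they
converge by right continuity. *)
Lemma right_continuous_progressive (t : R) : 0 <= t ->
  (forall s, 0 <= s <= t -> measurable_fun setT (X s)) ->
  measurable_fun setT (fun p : R * S => X (Num.max 0 (Num.min p.1 t)) p.2).
Proof.
move=> t0 mX; pose c s := Num.max 0 (Num.min s t).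
have c0 s : 0 <= c s by rewrite le_max lexx.
have ct s : c s <= t by rewrite ge_max t0 ge_min lexx orbT.
pose phi n k := Num.min (k.+1%:R / n.+1%:R) t.
apply: (@measurable_fun_cvg _ _ _ _
  (fun n p => X (phi n (Num.trunc (n.+1%:R * c p.1))) p.2)) => [n|[s w] _].
  apply: (@measurable_grid (phi n) (fun s => n.+1%:R * c s)) => [k|//|s].
  - by apply: mX; rewrite /phi le_min t0 ge_min lexx orbT !andbT divr_ge0.
  - apply: measurable_funM => //; apply: measurable_maxr => //; exact: measurable_minr.
  - exact: mulr_ge0.
rewrite /= -/(c s).
have trc n : c s < (Num.trunc (n.+1%:R * c s)).+1%:R / n.+1%:R <= c s + n.+1%:R^-1.
  have /andP[] := truncn_itv (mulr_ge0 (ler0n R n.+1) (c0 s)).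
  set k := Num.trunc _ => k1 k2.
  rewrite ltr_pdivlMr// mulrC k2/= ler_pdivrMr// mulrDl mulVf// -natr1 lerD2r.
  by rewrite mulrC.
have [cst|] := leP t (c s).
  have cE : c s = t by apply/eqP; rewrite eq_le cst ct.
  rewrite (_ : (fun n => _) = (fun=> X t w)); last first.
    apply/funext => n; congr X; apply/min_idPr; rewrite -[leLHS]cE; apply: ltW.
    by case/andP: (trc n).
  by rewrite cE; exact: cvg_cst.
move=> cst; have /cvg_at_rightP := @rcX w _ (c0 s); apply; split.
  by move=> n; rewrite /phi lt_min cst andbT; case/andP: (trc n).
apply: (@squeeze_cvgr _ _ _ _ (fun=> c s) (fun n => c s + n.+1%:R^-1)).
- apply: nearW => n; apply/andP; split.
    by rewrite le_min ct andbT; case/andP: (trc n) => /ltW.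
  by rewrite ge_min; case/andP: (trc n) => _ ->.
- exact: cvg_cst.
- rewrite -[X in _ --> X]addr0; apply: cvgD; [exact: cvg_cst|exact: cvg_harmonic].
Qed.

Lemma right_continuous_measurable : 
  (forall s, 0 <= s -> measurable_fun setT (X s)) ->
  measurable_fun setT (fun p : R * S => X (Num.max 0 p.1) p.2).
Proof.
move=> mX; apply: (@measurable_fun_cvg _ _ _ _
  (fun n (p : R * S) => X (Num.max 0 (Num.min p.1 n%:R)) p.2)) => [n|[s w] _ /=].
  by apply: right_continuous_progressive => // s /andP[s0 _]; exact: mX.
apply: cvg_near_cst; near=> n.
rewrite (_ : Num.min s _ = s)//; apply/min_idPl; near: n.
exists (Num.trunc `|s|).+1 => // n /=; rewrite -(ler_nat R); apply: le_trans.
by apply: le_trans (ler_norm s) _; apply/ltW; exact: truncnS_gt.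
Unshelve. all: by end_near.
Qed.

End right_continuous.

Section optional.
Context (R : realType) d (T : measurableType d) (F : R -> set (set T)).

(** Reduces the measurability of optional sets along [phi] to that of cadlag
adapted processes. With [phi] clamping the time between 0 and [t], it says that
optional sets are progressive; with [phi] the graph of a random time, it controls the
sigma-algebra at this time. *)
Lemma optional_preimage d' (S : measurableType d') (phi : S -> R * T) :
  (forall p, 0 <= (phi p).1) ->
  (forall X, adapted F X -> cadlag X ->
    measurable_fun setT (fun p => X (phi p).1 (phi p).2)) ->
  forall Gam, optional_sigma_algebra F Gam -> measurable (phi @^-1` Gam).
Proof.
move=> phi0 mX; pose H := [set A | measurable (phi @^-1` A)].
suff : optional_sigma_algebra F `<=` H by [].
apply: smallest_sub.
  split=> [|A mA|A mA]; rewrite /H/=.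
  - by rewrite preimage_set0.
  - rewrite (_ : _ @^-1` _ = ~` (phi @^-1` A)); first exact: measurableC.
    by apply/seteqP; split=> p /=; [case|move=> ?; split => //; exact: phi0].
  - by rewrite preimage_bigcup; exact: bigcupT_measurable.
move=> _ [X [aX cX] [B mB <-]]; rewrite /H/=.
rewrite (_ : _ @^-1` _ = setT `&` (fun p => X (phi p).1 (phi p).2) @^-1` B).
  exact: mX.
by apply/seteqP; split=> p /=; [case|case=> _ ?; split => //; exact: phi0].
Qed.

End optional.

(** * Debuts of optional sets *)

Section debut.
Context (R : realType) d (T : measurableType d) (P : probability T R)
  (F : R -> set (set T)).
Hypothesis uF : usual_conditions P F.

Lemma filtration_sigma t : 0 <= t -> sigma_algebra setT (F t).
Proof. by case: uF => -[+ _ _] _ _; exact. Qed.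

Lemma filtration_sub t : 0 <= t -> F t `<=` measurable.
Proof. by case: uF => -[_ + _] _ _; exact. Qed.

Lemma filtration_le s t : 0 <= s -> s <= t -> F s `<=` F t.
Proof. by case: uF => -[_ _ +] _ _; exact. Qed.

Lemma filtration_negligible t N : 0 <= t -> P.-negligible N -> F t N.
Proof. by move=> t0 nN; apply: (filtration_le _ t0) => //; case: uF => _ + _; exact. Qed.

Lemma adapted_progressive (X : R -> T -> R) t : 0 <= t -> adapted F X -> cadlag X ->
  measurable_fun setT (fun p : R * g_sigma_algebraType (F t) => X (Num.max 0 (Num.min p.1 t)) p.2).
Proof.
move=> t0 aX cX.
apply: (@right_continuous_progressive _ _ (g_sigma_algebraType (F t)) X) => //.
  by move=> w s s0; case: (cX w) => + _; exact.
move=> s /andP[s0 st]; apply/(measurable_wrtP _ (filtration_sigma t0)).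
by apply: subset_trans (aX s s0) _; exact: filtration_le.
Qed.

Definition debut (Gam : set (R * T)) (q : R) : T -> \bar R :=
  fun w => ereal_inf [set t%:E | t in [set t | q < t /\ Gam (t, w)]].

Lemma debut_ge Gam q w : (q%:E <= debut Gam q w)%E.
Proof. by apply: le_ereal_inf_tmp => _ [t [qt _] <-]; rewrite lee_fin ltW. Qed.

Lemma debut_lt Gam q w t : (debut Gam q w < t%:E)%E <-> exists s, [/\ q < s, Gam (s, w) & s < t].
Proof.
split=> [/ereal_inf_lt[_ [s [qs Gs] <-]]|[s [qs Gs st]]]; first by rewrite lte_fin => st; exists s.
by apply: (@le_lt_trans _ _ s%:E); [apply: ereal_inf_lbound; exists s|rewrite lte_fin].
Qed.

(** The event is the projection of the part of [Gam] between [q] and [t], which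
is measurable for [F t] because optional sets are progressive. *)
Lemma debut_lt_measurable Gam q t : optional_sigma_algebra F Gam -> 0 <= q -> 0 <= t ->
  F t [set w | (debut Gam q w < t%:E)%E].
Proof.
move=> oG q0 t0; have sF := filtration_sigma t0.
pose phi := fun p : R * g_sigma_algebraType (F t) => (Num.max 0 (Num.min p.1 t), p.2 : T).
have mG : measurable ((phi @^-1` Gam) `&` (`]q, t[ `*` setT)).
  apply: measurableI; last exact: measurableX.
  apply: optional_preimage oG => [p|X aX cX]; first by rewrite le_max lexx.
  exact: adapted_progressive.
have := measurable_projection sF (filtration_sub t0)
  (fun N => @filtration_negligible t N t0) mG.
congr F; apply/seteqP; split.
- move=> w [[s u] /= [Gs [sqt _]] uw]; rewrite uw in Gs; apply/debut_lt.
  move: sqt; rewrite /= in_itv/= => /andP[qs st]; exists s; split => //.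
  have sE : Num.max 0 (Num.min s t) = s.
    by rewrite (min_idPl (ltW st)); apply/max_idPr; rewrite (le_trans q0)// ltW.
  by move: Gs; rewrite /preimage /phi/= sE.
- move=> w /debut_lt[s [qs Gs st]]; exists (s, w) => //; split.
    have sE : Num.max 0 (Num.min s t) = s.
      by rewrite (min_idPl (ltW st)); apply/max_idPr; rewrite (le_trans q0)// ltW.
    by rewrite /preimage /phi/= sE.
  by split => //=; rewrite in_itv/= qs st.
Qed.

(** Right continuity of the filtration: [S <= t] is decided by the events
[S < u] for [u > t] close to [t]. *)
Lemma stopping_time_lt (S : T -> \bar R) : (forall w, (0 <= S w)%E) ->
  (forall t, 0 <= t -> F t [set w | (S w < t%:E)%E]) -> stopping_time F S.
Proof.
move=> S0 mS; split => // t t0; case: (uF) => _ _ /(_ t t0) -> s /= ts.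
pose u n := t + (s - t) / n.+1%:R.
have tu n : t < u n by rewrite ltrDl divr_gt0// subr_gt0.
have u0 n : 0 <= u n by rewrite (le_trans t0)// ltW.
have us n : u n <= s.
  by rewrite -lerBrDl ler_pdivrMr// ler_peMr ?ler1n// subr_ge0 ltW.
have sF : sigma_algebra setT (F s) by apply: filtration_sigma; rewrite (le_trans t0)// ltW.
rewrite -(g_measurableE sF) (_ : mkset _ = \bigcap_n [set w | (S w < (u n)%:E)%E]).
  apply: bigcapT_measurable => n; rewrite g_measurableE//.
  exact: (filtration_le (u0 n) (us n) (mS _ (u0 n))).
apply/seteqP; split=> [w /= Sw n _ /=|w Sw /=].
  by apply: le_lt_trans Sw _; rewrite lte_fin.
have : (fun n => (u n)%:E) @ \oo --> t%:E.
  apply: cvg_EFin; first exact: nearW.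
  rewrite -[X in _ --> X]addr0 -[X in _ --> _ + X](mulr0 (s - t)).
  apply: cvgD; first exact: cvg_cst.
  apply: cvgM; [exact: cvg_cst|exact: cvg_harmonic].
move=> cu; rewrite -(cvg_lim _ cu)//; apply: lime_ge; first by apply/cvg_ex; eexists; exact: cu.
by apply: nearW => n; apply/ltW; exact: Sw.
Qed.

Lemma debut_stopping_time Gam q : optional_sigma_algebra F Gam -> 0 <= q ->
  stopping_time F (debut Gam q).
Proof.
move=> oG q0; apply: stopping_time_lt => [w|t t0]; last exact: debut_lt_measurable.
by apply: le_trans (debut_ge Gam q w); rewrite lee_fin.
Qed.

End debut.

(** * Conditional expectations and squares *)

Section condexp.
Context (R : realType) d (T : measurableType d) (P : probability T R).
Implicit Types (X Y : T -> R) (A : set T).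

Lemma integrable_measurable_fun X : P.-integrable setT (EFin \o X) -> measurable_fun setT X.
Proof. by case/integrableP => /measurable_EFinP. Qed.

Lemma integral_affine X A a b : measurable A -> P.-integrable setT (EFin \o X) ->
  P.-integrable A (fun w => (a * X w + b)%:E) /\
  (\int[P]_(w in A) (a * X w + b)%:E = a%:E * \int[P]_(w in A) (X w)%:E + b%:E * P A)%E.
Proof.
move=> mA iX; have iA : P.-integrable A (EFin \o X) by exact: integrableS iX.
have iaX := integrableZl mA a iA.
have ib := finite_measure_integrable_cst P b mA.
have fE : (fun w => (a * X w + b)%:E) = ((fun w => a%:E * (EFin \o X) w) \+ (EFin \o cst b))%E.
  by apply/funext => w /=; rewrite EFinD EFinM.
rewrite fE; split; first exact: integrableD.
rewrite integralD// integralZl//; congr (_ + _)%E.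
by rewrite -integral_cst.
Qed.

Section jensen.
Variables (G : set (set T)) (X Y : T -> R).
Hypotheses (sG : sigma_algebra setT G) (Gm : G `<=` measurable).
Hypothesis XY : is_condexp P G X Y.

Let iX : P.-integrable setT (EFin \o X). Proof. by case: XY. Qed.
Let iY : P.-integrable setT (EFin \o Y). Proof. by case: XY. Qed.
Let mX : measurable_fun setT X. Proof. exact: integrable_measurable_fun. Qed.
Let mY : measurable_fun setT Y. Proof. exact: integrable_measurable_fun. Qed.

(** Compares both squares with the tangent line of the square at [c], namely
[x ^+ 2 >= 2 * c * x - c ^+ 2], which at [x = Y] loses at most [e ^+ 2]. The
integral over [A] of this affine function is the same for [X] and [Y]. *)
Lemma condexp_sq_le_cell A c e : G A -> (forall w, A w -> `|Y w - c| <= e) ->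
  (\int[P]_(w in A) ((Y w) ^+ 2)%:E <= \int[P]_(w in A) ((X w) ^+ 2 + e ^+ 2)%:E)%E.
Proof.
move=> GA Yce; have mA := Gm GA.
have [->|] := eqVneq (\int[P]_(w in A) ((X w) ^+ 2 + e ^+ 2)%:E)%E +oo%E; first by rewrite leey.
rewrite -ltey => Xoo.
have Xe0 w : 0 <= X w ^+ 2 + e ^+ 2 by rewrite addr_ge0 ?sqr_ge0.
have mX2 : measurable_fun A (fun w => (X w ^+ 2 + e ^+ 2)%:E).
  apply/measurable_EFinP; apply: measurable_funD => //; apply: measurable_funX.
  exact: measurable_funTS.
have [iaX aX] := integral_affine (2 * c) (e ^+ 2 - c ^+ 2) mA iX.
have [iaY aY] := integral_affine (2 * c) (e ^+ 2 - c ^+ 2) mA iY.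
apply: (@le_trans _ _ (\int[P]_(w in A) (2 * c * Y w + (e ^+ 2 - c ^+ 2))%:E)%E).
  apply: ge0_le_integral => //.
  - by move=> w Aw; rewrite lee_fin sqr_ge0.
  - apply/measurable_EFinP; apply: measurable_funX; exact: measurable_funTS.
  - by case/integrableP : iaY.
  - move=> w /Yce; rewrite lee_fin => H.
    rewrite -subr_ge0 (_ : _ - _ = e ^+ 2 - (Y w - c) ^+ 2); last by ring.
    rewrite subr_ge0 -[leLHS]real_normK ?num_real// lerXn2r ?nnegrE//.
    exact: le_trans H.
rewrite aY; case: XY => _ _ _ ->//; rewrite -aX; apply: le_integral => //.
- by apply/integrableP; split=> //; under eq_integral do rewrite gee0_abs ?lee_fin//.
- move=> w _; rewrite lee_fin -subr_ge0 (_ : _ - _ = (X w - c) ^+ 2); last by ring.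
  exact: sqr_ge0.
Qed.

(** Jensen's inequality on an event of [G], obtained from indicators alone by
cutting [A] into cells on which [Y] varies by at most [e]. *)
Lemma condexp_sq_le A : G A ->
  (\int[P]_(w in A) ((Y w) ^+ 2)%:E <= \int[P]_(w in A) ((X w) ^+ 2)%:E)%E.
Proof.
move=> GA; have mA := Gm GA; apply/lee_addgt0Pr => eps eps0.
pose e := Num.sqrt eps; have e0 : 0 < e by rewrite sqrtr_gt0.
have e2 : e ^+ 2 = eps by rewrite sqr_sqrtr// ltW.
have mXe : measurable_fun A (fun w => (X w ^+ 2 + e ^+ 2)%:E).
  apply/measurable_EFinP; apply: measurable_funD => //; apply: measurable_funX.
  exact: measurable_funTS.
apply: (@le_trans _ _ (\int[P]_(w in A) ((X w) ^+ 2 + e ^+ 2)%:E)%E); last first.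
  under eq_integral do rewrite EFinD.
  rewrite ge0_integralD//; last 3 first.
  - by move=> w _; rewrite lee_fin sqr_ge0.
  - by apply/measurable_EFinP; apply: measurable_funX; exact: measurable_funTS.
  - by move=> w _; rewrite lee_fin sqr_ge0.
  rewrite e2 leeD2l// (integral_cst _ mA) -[leRHS]mule1.
  by apply: lee_wpmul2l; [rewrite lee_fin ltW|exact: probability_le1].
(* the cells {m e <= Y < (m+1) e}, for m an integer, numbered by nat *)
pose B k := A `&` Y @^-1` [set y | pickle (Num.floor (y / e)) = k].
have BE k : (exists m : int, B k = A `&` Y @^-1` [set` `[m%:~R * e, (m + 1)%:~R * e[]) \/ B k = set0.
  have [[m mk]|nm] := pselect (exists m : int, pickle m = k); last first.
    right; apply/seteqP; split=> w // [_ /= Bk]; apply: nm; by eexists; exact: Bk.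
  left; exists m; apply/seteqP; split=> w [Aw] /=; rewrite in_itv/=.
    rewrite -mk => /(pcan_inj pickleK) <-; split=> //.
    by have /andP[h1 h2] := floor_itv (Y w / e); rewrite -ler_pdivlMr// h1/= -ltr_pdivrMr.
  move=> /andP[h1 h2]; split => //; rewrite -mk; congr pickle.
  by apply: floor_def; rewrite ler_pdivlMr// h1 ltr_pdivrMr.
have GI A1 A2 : G A1 -> G A2 -> G (A1 `&` A2).
  by rewrite -(g_measurableE sG); exact: measurableI.
have GB k : G (B k).
  have [[m ->]|->] := BE k; last by case: sG.
  apply: GI => //; case: XY => _ _ + _; apply.
  by exists [set` `[m%:~R * e, (m + 1)%:~R * e[]; [exact: measurable_itv|rewrite setTI].
have AB : A = \bigcup_k B k.
  by apply/seteqP; split=> [w Aw|w [k _ []//]]; exists (pickle (Num.floor (Y w / e))).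
have tB : trivIset setT B.
  apply/trivIsetP => i j _ _ /eqP ij; apply/seteqP; split=> w //= [[_ wi] [_ wj]].
  by apply: ij; rewrite -wi -wj.
have mB k := Gm (GB k).
rewrite AB ge0_integral_bigcup//; last 2 first.
- rewrite -AB; apply/measurable_EFinP; apply: measurable_funX; exact: measurable_funTS.
- by move=> w _; rewrite lee_fin sqr_ge0.
rewrite ge0_integral_bigcup//; last 2 first.
- by rewrite -AB.
- by move=> w _; rewrite lee_fin addr_ge0 ?sqr_ge0.
apply: lee_nneseries => [k _ _|k _].
  by apply: integral_ge0 => w _; rewrite lee_fin sqr_ge0.
have [[m Bm]|->] := BE k; last by rewrite !integral_set0.
apply: (@condexp_sq_le_cell _ (m%:~R * e)) => // w; rewrite Bm => -[_ /=].
rewrite in_itv/= intrD mulrDl mul1r => /andP[h1 h2]; rewrite ger0_norm ?subr_ge0//.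
by rewrite lerBlDl ltW.
Qed.

End jensen.
End condexp.

Section condexp_algebra.
Context (R : realType) d (T : measurableType d) (P : probability T R).
Implicit Types (X Y : T -> R) (A : set T) (G : set (set T)).

Lemma condexp_id G X : P.-integrable setT (EFin \o X) -> measurable_wrt G X -> is_condexp P G X X.
Proof. by []. Qed.

Lemma condexpD G X Y X' Y' : sigma_algebra setT G -> G `<=` measurable ->
  is_condexp P G X Y -> is_condexp P G X' Y' ->
  is_condexp P G (fun w => X w + X' w) (fun w => Y w + Y' w).
Proof.
move=> sG Gm [iX iY mY XY] [iX' iY' mY' XY'].
have intD U V : P.-integrable setT (EFin \o U) -> P.-integrable setT (EFin \o V) ->
    P.-integrable setT (EFin \o (fun w => U w + V w)).
  by move=> iU iV; have := integrableD measurableT iU iV.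
split; [exact: intD|exact: intD| |].
  move: mY mY' => /(measurable_wrtP _ sG) mY /(measurable_wrtP _ sG) mY'.
  by apply/measurable_wrtP => //; exact: measurable_funD.
move=> A GA; have mA := Gm _ GA.
have iS U : P.-integrable setT (EFin \o U) -> P.-integrable A (EFin \o U).
  exact: integrableS.
have E U V : P.-integrable setT (EFin \o U) -> P.-integrable setT (EFin \o V) ->
    (\int[P]_(w in A) (U w + V w)%:E = \int[P]_(w in A) (U w)%:E + \int[P]_(w in A) (V w)%:E)%E.
  by move=> iU iV; rewrite -integralD//; exact: iS.
by rewrite !E// XY// XY'.
Qed.

Lemma condexpN G X Y : sigma_algebra setT G -> G `<=` measurable ->
  is_condexp P G X Y -> is_condexp P G (fun w => - X w) (fun w => - Y w).
Proof.
move=> sG Gm [iX iY mY XY].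
have intN U : P.-integrable setT (EFin \o U) -> P.-integrable setT (EFin \o (fun w => - U w)).
  by move=> iU; have := integrableN iU.
split; [exact: intN|exact: intN| |].
  move: mY => /(measurable_wrtP _ sG) mY.
  by apply/measurable_wrtP => //; exact: measurableT_comp.
move=> A GA; have mA := Gm _ GA.
have E U : P.-integrable setT (EFin \o U) ->
    (\int[P]_(w in A) (- U w)%:E = - \int[P]_(w in A) (U w)%:E)%E.
  move=> iU; have [_] := integral_affine (-1) 0 mA iU.
  by under eq_integral do rewrite mulN1r addr0; move=> ->; rewrite mul0e adde0 EFinN mulN1e.
by rewrite !E// XY.
Qed.

Lemma condexpB G X Y X' Y' : sigma_algebra setT G -> G `<=` measurable ->
  is_condexp P G X Y -> is_condexp P G X' Y' ->
  is_condexp P G (fun w => X w - X' w) (fun w => Y w - Y' w).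
Proof. by move=> sG Gm XY /(condexpN sG Gm); exact: condexpD. Qed.

(** Bounds the increment [X - Y] by the growth of the second moment: in the
parallelogram identity, Jensen's inequality applies to [X + Y], whose conditional
expectation is [2 * Y]. *)
Lemma condexp_sqB_le G X Y : sigma_algebra setT G -> G `<=` measurable ->
  is_condexp P G X Y ->
  (\int[P]_w ((X w - Y w) ^+ 2)%:E + 2%:E * \int[P]_w ((Y w) ^+ 2)%:E <=
   2%:E * \int[P]_w ((X w) ^+ 2)%:E)%E.
Proof.
move=> sG Gm XY; have [iX iY mY _] := XY.
have GT : G setT by rewrite -setC0 -setTD; case: sG => + + _ => G0; exact.
have mX := integrable_measurable_fun iX; have mY' := integrable_measurable_fun iY.
have XYY : is_condexp P G (fun w => X w + Y w) (fun w => Y w + Y w).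
  by apply: condexpD => //; exact: condexp_id.
have J1 := condexp_sq_le sG Gm XY GT; have J2 := condexp_sq_le sG Gm XYY GT.
have p2 (U : T -> R) w : setT w -> (0 <= ((U w) ^+ 2)%:E)%E by rewrite lee_fin sqr_ge0.
have [->|] := eqVneq (\int[P]_w ((X w) ^+ 2)%:E)%E +oo%E.
  by rewrite gt0_muley ?lte_fin ?leey// ltr0n.
rewrite -ltey => Xoo.
have fX : (\int[P]_w ((X w) ^+ 2)%:E)%E \is a fin_num.
  by rewrite ge0_fin_numE//; apply: integral_ge0 => w _; exact: p2.
have fY : (\int[P]_w ((Y w) ^+ 2)%:E)%E \is a fin_num.
  by rewrite ge0_fin_numE; [exact: le_lt_trans J1 _|apply: integral_ge0 => w _; exact: p2].
have addI (f g : T -> R) : measurable_fun setT f -> measurable_fun setT g ->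
    (forall w, 0 <= f w) -> (forall w, 0 <= g w) ->
    (\int[P]_w (f w)%:E + \int[P]_w (g w)%:E = \int[P]_w (f w + g w)%:E)%E.
  move=> mf mg f0 g0; rewrite -ge0_integralD//; try (by move=> w _; rewrite lee_fin);
    exact/measurable_EFinP.
have sclI (f : T -> R) c : measurable_fun setT f -> (forall w, 0 <= f w) -> 0 <= c ->
    (c%:E * \int[P]_w (f w)%:E = \int[P]_w (c * f w)%:E)%E.
  move=> mf f0 c0; rewrite -ge0_integralZl//; first exact/measurable_EFinP.
  by move=> w _; rewrite lee_fin.
have mX2 := measurable_funX 2 mX; have mY2 := measurable_funX 2 mY'.
have mB2 := measurable_funX 2 (measurable_funB mX mY').
have mD2 := measurable_funX 2 (measurable_funD mX mY').
have : (\int[P]_w ((X w - Y w) ^+ 2)%:E + \int[P]_w ((X w + Y w) ^+ 2)%:E =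
    2%:E * \int[P]_w ((X w) ^+ 2)%:E + 2%:E * \int[P]_w ((Y w) ^+ 2)%:E)%E.
  rewrite !sclI//; try by move=> w; exact: sqr_ge0.
  rewrite !addI//; try exact: measurable_funM; try (by move=> w; exact: sqr_ge0);
    try (by move=> w; apply: mulr_ge0 => //; exact: sqr_ge0).
  by apply: eq_integral => w _; congr EFin; ring.
move=> PE.
have J3 : (4%:E * \int[P]_w ((Y w) ^+ 2)%:E <= \int[P]_w ((X w + Y w) ^+ 2)%:E)%E.
  apply: le_trans J2; rewrite sclI//; last by move=> w; exact: sqr_ge0.
  by rewrite le_eqVlt; apply/orP; left; apply/eqP/eq_integral => w _; congr EFin; ring.
have f2Y : (2%:E * \int[P]_w ((Y w) ^+ 2)%:E)%E \is a fin_num by rewrite fin_numM.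
rewrite -(leeD2rE _ _ f2Y).
rewrite -PE -addeA leeD2l//; apply: le_trans J3.
by rewrite -(fineK fY) -!EFinM -EFinD lee_fin; lra.
Qed.

End condexp_algebra.

(** * The maximal inequality *)

Section maximal.
Context (R : realType) d (T : measurableType d) (P : probability T R).
Variables (F : R -> set (set T)) (X : R -> T -> R) (C : R).
Hypothesis fF : filtration F.
Hypothesis rcX : forall (w : T) (t : R), 0 <= t -> X s w @[s --> t^'+] --> X t w.
Hypothesis cX : forall s t : R, 0 <= s -> s <= t -> is_condexp P (F s) (X t) (X s).
Hypothesis XC : forall t : R, 0 <= t -> (\int[P]_w ((X t w) ^+ 2)%:E <= C%:E)%E.

Let sF (t : R) : 0 <= t -> sigma_algebra setT (F t). Proof. by case: fF => + _ _; apply. Qed.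
Let Fm (t : R) : 0 <= t -> F t `<=` measurable. Proof. by case: fF => _ + _; apply. Qed.
Let Fle (s t : R) : 0 <= s -> s <= t -> F s `<=` F t. Proof. by case: fF => _ _; apply. Qed.
Let iX (t : R) : 0 <= t -> P.-integrable setT (EFin \o X t).
Proof. by move=> t0; case: (cX t0 (lexx t)). Qed.
Let mX (t : R) : 0 <= t -> measurable_fun setT (X t).
Proof. by move=> t0; exact: (integrable_measurable_fun (iX t0)). Qed.

Lemma level_measurable t (lam : R) : 0 <= t -> F t [set w | lam < `|X t w|].
Proof.
move=> t0; have [_ _ + _] := cX t0 (lexx t).
move=> /(measurable_wrtP _ (sF t0)) mXt.
have : measurable_fun setT (fun w : g_sigma_algebraType (F t) => `|X t w|).
  exact: measurableT_comp.
move=> /(_ measurableT `]lam, +oo[%classic (measurable_itv _)).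
rewrite g_measurableE ?setTI; last exact: sF.
by congr F; apply/seteqP; split=> w /=; rewrite in_itv/= andbT.
Qed.

(** Induction on [n]. Where the level has already been exceeded, Jensen's
inequality carries the bound to the next time; where it is exceeded for the first
time, the square is at least [lam ^+ 2]. *)
Lemma maximal_discrete (u : nat -> R) (lam : R) n : 0 <= lam ->
  (forall k, 0 <= u k) -> {homo u : m n / (m <= n)%N >-> m <= n} ->
  let B := [set w | exists2 k, (k < n)%N & lam < `|X (u k) w|] in
  measurable B /\
  ((lam ^+ 2)%:E * P B <= \int[P]_(w in B) ((X (u n) w) ^+ 2)%:E)%E.
Proof.
move=> lam0 u0 nu.
pose B n := [set w | exists2 k, (k < n)%N & lam < `|X (u k) w|].
suff : measurable (B n) /\ ((lam ^+ 2)%:E * P (B n) <= \int[P]_(w in B n) ((X (u n) w) ^+ 2)%:E)%E by [].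
have B0 : B 0%N = set0 by apply/seteqP; split=> w // [].
have BS m : B m.+1 = B m `|` [set w | lam < `|X (u m) w|].
  apply/seteqP; split=> w; last by case=> [[k km]|]; [exists k => //; exact: ltnW|exists m].
  by case=> k; rewrite ltnS leq_eqVlt => /predU1P[->|km] kw; [right|left; exists k].
have FB m t : (forall k, (k < m)%N -> u k <= t) -> 0 <= t -> F t (B m).
  move=> um t0; elim: m um => [_|m IH um].
    by rewrite B0; case: (sF t0).
  rewrite BS -(g_measurableE (sF t0)); apply: measurableU; rewrite g_measurableE//; try exact: sF.
    by apply: IH => k km; apply: um; exact: ltnW.
  by apply: (Fle (u0 m) (um m (ltnSn m))); exact: level_measurable.
have FBu m : F (u m) (B m.+1).
  by apply: FB => // k; rewrite ltnS; exact: nu.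
have mB m : measurable (B m) by apply: (Fm (u0 m)); apply: FB => // k /ltnW; exact: nu.
split => //; elim: n => [|n IH].
  by rewrite B0 measure0 mule0 integral_set0.
apply: (le_trans _ (condexp_sq_le (sF (u0 n)) (Fm (u0 n)) (cX (u0 n) (nu _ _ (leqnSn n))) (FBu n))).
pose D := [set w | lam < `|X (u n) w|] `\` B n.
have mL : measurable [set w | lam < `|X (u n) w|] by apply: (Fm (u0 n)); exact: level_measurable.
have mD : measurable D by exact: measurableD.
have BD : B n `&` D = set0 by apply/seteqP; split=> w // [Bw []].
have BSD : B n.+1 = B n `|` D by rewrite BS /D setUDr setDv setD0.
have mX2 (A : set T) : measurable_fun A (fun w => (X (u n) w ^+ 2)%:E).
  by apply/measurable_EFinP; apply: measurable_funX; apply: measurable_funTS; exact: mX.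
rewrite BSD measureU// ge0_integral_setU//; last 2 first.
- by move=> w _; rewrite lee_fin sqr_ge0.
- by apply/disj_setPS; rewrite BD.
rewrite ge0_muleDr//; apply: leeD => //.
rewrite -integral_cst//; apply: ge0_le_integral => //.
- by move=> w _; rewrite lee_fin sqr_ge0.
- move=> w [/= lw _]; rewrite lee_fin -[leRHS]real_normK ?num_real//.
  by rewrite lerXn2r ?nnegrE// ltW.
Qed.

Let S (lam : R) m := [set w | exists2 k, (k < (m * 2 ^ m).+1)%N & lam < `|X (k%:R / (2 ^ m)%:R) w|].

(** The inequality [lam < `|X t w|] is strict, so by right continuity it
persists at some dyadic time after [t]. The grid of mesh [2 ^- m] is cut at time
[m], and these finite grids increase with [m]. *)
Lemma exists_dyadic (lam : R) :
  [set w | exists2 t, 0 <= t & lam < `|X t w|] = \bigcup_m S lam m.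
Proof.
apply/seteqP; split=> [w [t t0 lw]|w [m _ [k _ kw]]]; last first.
  by exists (k%:R / (2 ^ m)%:R) => //; rewrite divr_ge0.
have := cvgr_norm_gt _ (@rcX w t t0) lam lw; rewrite /at_right => -[e /= e0 He].
pose m := ((Num.trunc e^-1).+1 + (Num.trunc t).+1).+1%N.
exists m => //; pose D : R := (2 ^ m)%:R; have D0 : 0 < D by rewrite ltr0n expn_gt0.
have mD : m%:R < D by rewrite ltr_nat ltn_expl.
have tm : t + 1 <= m%:R.
  rewrite /m -natr1 lerD2r natrD; apply: ltW; apply: (lt_le_trans (truncnS_gt t)).
  by rewrite lerDr.
have eD : D^-1 < e.
  rewrite -[ltRHS]invrK ltf_pV2 ?posrE ?invr_gt0//; apply: lt_trans mD.
  apply: (lt_le_trans (truncnS_gt _)); rewrite ler_nat /m -addnS; exact: leq_addr.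
have /andP[k1 k2] := truncn_itv (mulr_ge0 t0 (ltW D0)).
set k := Num.trunc _ in k1 k2.
exists k.+1.
  rewrite ltnS -(ltr_nat R) natrM -/D; apply: (le_lt_trans k1).
  rewrite ltr_pM2r//; apply: lt_le_trans tm; by rewrite ltrDl.
apply: He.
  rewrite /= -/D distrC ger0_norm; last by rewrite subr_ge0 ler_pdivlMr// ltW.
  apply: le_lt_trans eD; rewrite lerBlDr ler_pdivrMr// mulrDl mulVf ?gt_eqF//.
  by rewrite -natr1 addrC lerD2l.
by rewrite /= -/D ltr_pdivlMr.
Qed.

Lemma L2_maximal_inequality (lam : R) : 0 < lam ->
  let B := [set w | exists2 t, 0 <= t & lam < `|X t w|] in
  measurable B /\ (P B <= (C / lam ^+ 2)%:E)%E.
Proof.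
move=> lam0 B; rewrite /B exists_dyadic.
have u0 m k : 0 <= k%:R / (2 ^ m)%:R :> R by rewrite divr_ge0.
have nu m : {homo (fun k => k%:R / (2 ^ m)%:R : R) : k n / (k <= n)%N >-> k <= n}.
  by move=> k n kn; rewrite ler_wpM2r ?invr_ge0// ler_nat.
have mS m : measurable (S lam m).
  by have [] := @maximal_discrete (fun k => k%:R / (2 ^ m)%:R) lam (m * 2 ^ m).+1
    (ltW lam0) (u0 m) (nu m).
have PS m : (P (S lam m) <= (C / lam ^+ 2)%:E)%E.
  have [_ H] := @maximal_discrete (fun k => k%:R / (2 ^ m)%:R) lam (m * 2 ^ m).+1
    (ltW lam0) (u0 m) (nu m).
  rewrite mulrC EFinM lee_pdivlMl ?exprn_gt0//; apply: le_trans H _.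
  apply: le_trans (XC (u0 m (m * 2 ^ m).+1)); apply: ge0_subset_integral => //.
    exact: mS.
    by apply/measurable_EFinP; apply: measurable_funX; exact: mX.
  by move=> w _; rewrite lee_fin sqr_ge0.
have mU : measurable (\bigcup_m S lam m) by exact: bigcupT_measurable.
split => //.
have ndS : nondecreasing_seq (S lam).
  apply/nondecreasing_seqP => m; apply/subsetPset => w [k km kw].
  exists (2 * k)%N.
    rewrite ltnS expnS mulnCA leq_mul2l/=; rewrite ltnS in km; apply: leq_trans km _.
    by rewrite leq_mul2r leqnSn orbT.
  by rewrite expnS !natrM -mulf_div divff ?mul1r.
have cP : P \o S lam @ \oo --> P (\bigcup_m S lam m) by exact: nondecreasing_cvg_mu.
rewrite -(cvg_lim _ cP)//; apply: lime_le; first by apply/cvg_ex; eexists; exact: cP.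
exact: nearW.
Qed.

End maximal.

(** * Convergence of martingales bounded in L2 *)

Section convergence.
Context (R : realType) d (T : measurableType d) (P : probability T R).
Variables (F : R -> set (set T)) (X : R -> T -> R) (C : R).
Hypothesis fF : filtration F.
Hypothesis rcX : forall (w : T) (t : R), 0 <= t -> X s w @[s --> t^'+] --> X t w.
Hypothesis cX : forall s t : R, 0 <= s -> s <= t -> is_condexp P (F s) (X t) (X s).
Hypothesis XC : forall t : R, 0 <= t -> (\int[P]_w ((X t w) ^+ 2)%:E <= C%:E)%E.

Let sF (t : R) : 0 <= t -> sigma_algebra setT (F t). Proof. by case: fF => + _ _; apply. Qed.
Let Fm (t : R) : 0 <= t -> F t `<=` measurable. Proof. by case: fF => _ + _; apply. Qed.
Let Fle (s t : R) : 0 <= s -> s <= t -> F s `<=` F t. Proof. by case: fF => _ _; apply. Qed.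
Let iX (t : R) : 0 <= t -> P.-integrable setT (EFin \o X t).
Proof. by move=> t0; case: (cX t0 (lexx t)). Qed.
Let mX (t : R) : 0 <= t -> measurable_fun setT (X t).
Proof. by move=> t0; exact: (integrable_measurable_fun (iX t0)). Qed.
Let FT (t : R) : 0 <= t -> F t setT.
Proof. by move=> t0; rewrite -(g_measurableE (sF t0)); exact: measurableT. Qed.

Let C0 : 0 <= C.
Proof.
rewrite -lee_fin; apply: le_trans (XC (lexx 0)).
by apply: integral_ge0 => w _; rewrite lee_fin sqr_ge0.
Qed.

Lemma exceed_measurable (lam : R) : measurable [set w | exists2 t, 0 <= t & lam < `|X t w|].
Proof.
rewrite (exists_dyadic rcX); apply: bigcupT_measurable => m.
rewrite (_ : mkset _ = \bigcup_(k in [set k | (k < (m * 2 ^ m).+1)%N])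
    [set w | lam < `|X (k%:R / (2 ^ m)%:R) w|]).
  apply: bigcup_measurable => k _.
  have u0 : 0 <= k%:R / (2 ^ m)%:R :> R by rewrite divr_ge0.
  by apply: (Fm u0); exact: (level_measurable fF cX).
by apply/seteqP; split=> w [k km kw]; exists k.
Qed.

Definition running_sup (w : T) : \bar R :=
  ereal_sup [set `|X t w|%:E | t in [set t | (0 <= t)%R]].

Lemma running_sup_ub w t : 0 <= t -> (`|X t w|%:E <= running_sup w)%E.
Proof. by move=> t0; apply: ereal_sup_ubound; exists t. Qed.

Lemma running_sup_ge0 w : (0 <= running_sup w)%E.
Proof. by apply: le_trans (running_sup_ub w (lexx 0)); rewrite lee_fin. Qed.

Lemma running_sup_gt w (lam : R) :
  (lam%:E < running_sup w)%E <-> exists2 t, 0 <= t & lam < `|X t w|.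
Proof.
split=> [/ereal_sup_gt[_ [t t0 <-]]|[t t0 lt]]; first by rewrite lte_fin; exists t.
by apply: lt_le_trans (running_sup_ub w t0); rewrite lte_fin.
Qed.

Lemma running_sup_measurable : measurable_fun setT running_sup.
Proof.
apply: (measurability _ (ErealGenOInfty.measurableE R)) => _ [_ [lam ->] <-].
rewrite setTI (_ : _ @^-1` _ = [set w | exists2 t, 0 <= t & lam < `|X t w|]).
  exact: exceed_measurable.
by apply/seteqP; split=> w /=; rewrite in_itv/= andbT => /running_sup_gt.
Qed.

Let cut n w := Order.min (running_sup w) (2 ^+ n)%:E.

Let cut_measurable n : measurable_fun setT (cut n).
Proof. by apply: measurable_mine; [exact: running_sup_measurable|exact: measurable_cst]. Qed.

Let cut_ge0 n w : (0 <= cut n w)%E.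
Proof. by rewrite le_min running_sup_ge0 lee_fin exprn_ge0. Qed.

Let lev n : set T := [set w | exists2 t : R, 0 <= t & 2 ^+ n < `|X t w|].

Let cut_step n w : (cut n.+1 w <= cut n w + (2 ^+ n * \1_(lev n) w)%:E)%E.
Proof.
rewrite /cut indicE; case: (boolP (w \in lev n)) => [|/negP]; rewrite inE.
  move=> /running_sup_gt Bw; rewrite (min_idPr (ltW Bw)) mulr1.
  by rewrite -EFinD ge_min exprS; apply/orP; right; rewrite lee_fin; lra.
move=> nB; rewrite mulr0 adde0.
have gn : (running_sup w <= (2 ^+ n)%:E)%E.
  by rewrite leNgt; apply/negP => /running_sup_gt.
by rewrite (min_idPl gn) ge_min lexx.
Qed.

(** Doubling the cap adds at most [2 ^+ n] times the probability of exceeding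
[2 ^+ n], that is [C / 2 ^+ n] by the maximal inequality: a summable amount. *)
Let cut_int n : (\int[P]_w cut n w <= (1 + 2 * C - 2 * C / 2 ^+ n)%:E)%E.
Proof.
elim: n => [|n IH].
  apply: (@le_trans _ _ (\int[P]_w (cst 1%E w))%E).
    apply: ge0_le_integral => // w _; by rewrite /cut ge_min expr0 lexx orbT.
  rewrite integral_cst// mul1e; apply: (le_trans (probability_le1 P measurableT)).
  by rewrite lee_fin expr0; lra.
have p2 : 0 < 2 ^+ n :> R by rewrite exprn_gt0.
have [mB PB] : measurable (lev n) /\ (P (lev n) <= (C / (2 ^+ n) ^+ 2)%:E)%E.
  exact: (L2_maximal_inequality fF rcX cX XC p2).
apply: (@le_trans _ _ (\int[P]_w (cut n w + (2 ^+ n * \1_(lev n) w)%:E))%E).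
  apply: ge0_le_integral => //.
  by apply: emeasurable_funD => //; apply/measurable_EFinP; apply: measurable_funM.
rewrite ge0_integralD//; last first.
- by apply/measurable_EFinP; apply: measurable_funM.
under [X in (_ + X)%E]eq_integral do rewrite EFinM.
rewrite ge0_integralZl//; last exact/measurable_EFinP.
rewrite integral_indic// setIT.
apply: le_trans (leeD IH (lee_wpmul2l _ PB)) _; first by rewrite lee_fin ltW.
rewrite -EFinM -EFinD lee_fin [2 ^+ n.+1]exprS; move: (2 ^+ n) p2 => x x0.
rewrite le_eqVlt; apply/orP; left; apply/eqP; field.
by rewrite gt_eqF.
Qed.

Lemma running_sup_integral : (\int[P]_w running_sup w < +oo)%E.
Proof.
apply: (@le_lt_trans _ _ (1 + 2 * C)%:E); last by rewrite ltry.
have cutE w : limn (cut ^~ w) = running_sup w.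
  apply: cvg_lim => //; rewrite /cut; have := running_sup_ge0 w.
  have n2 n : n%:R <= 2 ^+ n :> R by rewrite -natrX ler_nat ltnW// ltn_expl.
  case: (running_sup w) => [r| |//] _.
  - apply: cvg_near_cst; exists (Num.trunc `|r|).+1 => // n /=.
    rewrite -(ler_nat R) => rn; apply/min_idPl; rewrite lee_fin; apply: le_trans (n2 n).
    apply: le_trans rn; apply: le_trans (ler_norm r) _; apply/ltW; exact: truncnS_gt.
  - apply/cvgeyPge => A; exists (Num.trunc `|A|).+1 => // n /=.
    rewrite -(ler_nat R) => An; rewrite min_r ?leey// lee_fin; apply: le_trans (n2 n).
    apply: le_trans An; apply: le_trans (ler_norm A) _; apply/ltW; exact: truncnS_gt.
have ndcut w : setT w -> {homo cut ^~ w : n m / (n <= m)%N >-> (n <= m)%E}.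
  move=> _ n m nm; rewrite /cut le_min ge_min lexx ge_min lee_fin/=.
  by rewrite ler_weXn2l ?orbT// ler1n.
have cvi := cvg_monotone_convergence measurableT cut_measurable (fun n w _ => cut_ge0 n w) ndcut.
have -> : (\int[P]_w running_sup w = \int[P]_w limn (cut ^~ w))%E.
  by apply: eq_integral => w _; rewrite cutE.
rewrite -(cvg_lim _ (cvi P))//; apply: lime_le; first by apply/cvg_ex; eexists; exact: cvi.
apply: nearW => n; apply: le_trans (cut_int n) _.
by rewrite lee_fin gerBl divr_ge0 ?mulr_ge0.
Qed.

Lemma running_sup_integrable : P.-integrable setT running_sup.
Proof.
apply/integrableP; split; first exact: running_sup_measurable.
under eq_integral do rewrite gee0_abs ?running_sup_ge0//.
exact: running_sup_integral.
Qed.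

Let a t := fine (\int[P]_w ((X t w) ^+ 2)%:E)%E.

Let aE t : 0 <= t -> (\int[P]_w ((X t w) ^+ 2)%:E = (a t)%:E)%E.
Proof.
move=> t0; rewrite fineK// ge0_fin_numE; first by apply: le_lt_trans (XC t0) _; rewrite ltry.
by apply: integral_ge0 => w _; rewrite lee_fin sqr_ge0.
Qed.

Let a_le s t : 0 <= s -> s <= t -> a s <= a t.
Proof.
move=> s0 st; rewrite -lee_fin -!aE//; last exact: le_trans st.
exact: (condexp_sq_le (sF s0) (Fm s0) (cX s0 st) (FT s0)).
Qed.

(** The maximal inequality for the martingale started afresh at time [n]. *)
Lemma tail_maximal (lam : R) (n : R) e : 0 < lam -> 0 <= n ->
  (forall t, n <= t -> a t <= a n + e) ->
  let B := [set w | exists2 t, 0 <= t & lam < `|X (n + t) w - X n w|] in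
  measurable B /\ (P B <= (2 * e / lam ^+ 2)%:E)%E.
Proof.
move=> lam0 n0 ae.
apply: (@L2_maximal_inequality _ _ _ P (fun t => F (n + t)) (fun t w => X (n + t) w - X n w)) => //.
- split=> [t t0|t t0|s t s0 st].
  + by apply: sF; rewrite addr_ge0.
  + by apply: Fm; rewrite addr_ge0.
  + by apply: Fle; [rewrite addr_ge0|rewrite lerD2l].
- move=> w t t0; apply: cvgB; last exact: cvg_cst.
  have /cvg_at_rightP H := @rcX w (n + t) (addr_ge0 n0 t0).
  apply/cvg_at_rightP => u [ut cu]; apply: (H (fun k => n + u k)); split.
    by move=> k; rewrite ltrD2l.
  by apply: cvgD => //; exact: cvg_cst.
- move=> s t s0 st; have ns0 : 0 <= n + s by rewrite addr_ge0.
  apply: (condexpB (sF ns0) (Fm ns0)); first by apply: cX => //; rewrite lerD2l.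
  apply: condexp_id; first exact: iX.
  have [_ _ mXn _] := cX n0 (lexx n); apply: subset_trans mXn _.
  by apply: Fle => //; rewrite lerDl.
- move=> t t0; have nt : n <= n + t by rewrite lerDl.
  have := condexp_sqB_le (sF n0) (Fm n0) (cX n0 nt).
  rewrite !aE ?addr_ge0// -!EFinM -leeBrDr// -EFinB => /le_trans; apply.
  by rewrite lee_fin; have := ae _ nt; lra.
Qed.

(** The second moments increase to a finite limit, so the increments after a
late time are uniformly small with large probability: almost every path is
Cauchy. *)
Lemma converges_ae : exists N, [/\ measurable N, P N = 0%E &
  forall w, ~ N w -> cvg (X t w @[t --> +oo%R])].
Proof.
have small e : 0 < e -> exists2 n : nat, 0 <= n%:R :> R & forall t, n%:R <= t -> a t <= a n%:R + e.
  move=> e0; pose V := [set a n%:R | n in [set: nat]].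
  have V0 : V !=set0 by exists (a 0%:R); exists 0%N.
  have hV : has_ubound V.
    by exists C => _ [n _ <-]; rewrite -lee_fin -aE//; exact: XC.
  have [_ [n _ <-] Vn] := sup_adherent e0 (conj V0 hV).
  exists n => // t nt; have t0 : 0 <= t by exact: le_trans nt.
  have tN : t <= (Num.trunc t).+1%:R by apply/ltW; exact: truncnS_gt.
  apply: (le_trans (a_le t0 tN)); rewrite -lerBlDr; apply: le_trans (ltW Vn); rewrite lerD2r.
  by apply: ub_le_sup => //; exists (Num.trunc t).+1.
pose E (j n : nat) := [set w | exists2 t, 0 <= t & j.+1%:R^-1 < `|X (n%:R + t) w - X n%:R w|].
have j0 j : 0 < j.+1%:R^-1 :> R by rewrite invr_gt0.
have mE j n : measurable (E j n).
  have [] := @tail_maximal j.+1%:R^-1 n%:R C (j0 j) (ler0n _ _); last by [].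
  move=> t nt; have t0 : 0 <= t by exact: le_trans nt.
  apply: (@le_trans _ _ C); first by rewrite -lee_fin -aE//; exact: XC.
  by rewrite lerDr -lee_fin -aE//; apply: integral_ge0 => w _; rewrite lee_fin sqr_ge0.
have mI j : measurable (\bigcap_n E j n) by exact: bigcapT_measurable.
have PI j : P (\bigcap_n E j n) = 0%E.
  apply/eqP; rewrite eq_le measure_ge0 andbT; apply/lee_addgt0Pr => e e0; rewrite add0e.
  have e'0 : 0 < e * (j.+1%:R^-1) ^+ 2 / 2 by rewrite divr_gt0// mulr_gt0// exprn_gt0.
  have [n n0 an] := small _ e'0.
  have [_ PE] := tail_maximal (j0 j) n0 an.
  apply: (@le_trans _ _ (P (E j n))).
    by apply: le_measure; rewrite ?inE//; exact: bigcap_inf.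
  apply: le_trans PE _; rewrite lee_fin le_eqVlt; apply/orP; left; apply/eqP.
  by field; rewrite ?gt_eqF.
exists (\bigcup_j \bigcap_n E j n); split.
- exact: bigcupT_measurable.
- have : P.-negligible (\bigcup_j \bigcap_n E j n).
    by apply: negligible_bigcup => j; apply/negligibleP => //; exact: PI.
  by move/negligibleP; apply; exact: bigcupT_measurable.
move=> w nw; apply/cauchy_cvgP; apply: cauchy_exP => e e0.
pose j := Num.trunc e^-1.
have je : j.+1%:R^-1 < e.
  by rewrite -[ltRHS]invrK ltf_pV2 ?posrE ?invr_gt0//; exact: truncnS_gt.
have [n nE] : exists n, ~ E j n w.
  by apply: contrapT => /forallNP H; apply: nw; exists j => // n _; apply: contrapT; exact: H.
exists (X n%:R w); rewrite /= /fmap /=; exists n%:R; split; first exact: num_real.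
move=> t nt; rewrite /= -ball_normE /=; rewrite distrC.
apply: le_lt_trans je; rewrite leNgt; apply/negP => H; apply: nE.
by exists (t - n%:R); [rewrite subr_ge0 ltW|rewrite (addrC n%:R) subrK].
Qed.

Section terminal.
Hypothesis Pc : forall N, P.-negligible N -> measurable N.

Lemma cvg_terminal : exists N, [/\ measurable N, P N = 0%E &
  forall w, ~ N w -> X n%:R w @[n --> \oo] --> terminal X w].
Proof.
have [N [mN N0 cN]] := converges_ae; exists N; split => // w /cN cw.
by apply: cvg_comp cw; exact: cvgr_idn.
Qed.

(** [terminal X] is arbitrary on the null set where the paths diverge;
completeness makes it measurable all the same. *)
Lemma terminal_measurable : measurable_fun setT (terminal X).
Proof.
have [N [mN N0 cN]] := cvg_terminal; move=> _ B mB; rewrite setTI.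
rewrite (_ : _ @^-1` _ = (~` N `&` terminal X @^-1` B) `|` (N `&` terminal X @^-1` B)).
  apply: measurableU.
    have : measurable_fun (~` N) (terminal X).
      apply: (@measurable_fun_cvg _ _ _ _ (fun n => X n%:R)) => // n.
      by apply: measurable_funTS; exact: mX.
    by apply => //; exact: measurableC.
  by apply: Pc; apply: (@negligibleS _ _ _ P N); [exact: subIsetl|exact/negligibleP].
by rewrite -setIUl setUC setUv setTI.
Qed.

Lemma terminal_dominated A : measurable A ->
  P.-integrable A (EFin \o terminal X) /\
  (\int[P]_(w in A) (X n%:R w)%:E)%E @[n --> \oo] --> (\int[P]_(w in A) (terminal X w)%:E)%E.
Proof.
move=> mA; have [N [mN N0 cN]] := cvg_terminal.
have := @dominated_convergence _ _ _ P A mA (fun n w => (X n%:R w)%:E) (EFin \o terminal X) running_sup.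
case=> //.
- by move=> n; apply/measurable_EFinP; apply: measurable_funTS; exact: mX.
- by apply/measurable_EFinP; apply: measurable_funTS; exact: terminal_measurable.
- exists N; split=> // w /= H; apply: contrapT => /cN cw; apply: H => _.
  by apply: cvg_EFin => //; exact: nearW.
- exact: integrableS running_sup_integrable.
- by apply: aeW => w n _; rewrite abse_EFin; exact: running_sup_ub.
Qed.

Lemma terminal_integrable : P.-integrable setT (EFin \o terminal X).
Proof. by case: (terminal_dominated measurableT). Qed.

Lemma terminal_closes t A : 0 <= t -> F t A ->
  (\int[P]_(w in A) (terminal X w)%:E = \int[P]_(w in A) (X t w)%:E)%E.
Proof.
move=> t0 FA; have [_ cA] := terminal_dominated (Fm t0 FA).
rewrite -(cvg_lim _ cA)//; apply: cvg_lim => //; apply: cvg_near_cst.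
exists (Num.trunc t).+1 => // n /=; rewrite -(ler_nat R) => tn.
have tn' : t <= n%:R by apply: le_trans tn; apply/ltW; exact: truncnS_gt.
by case: (cX t0 tn') => _ _ _ ->.
Qed.

Lemma terminal_sq_le : (\int[P]_w ((terminal X w) ^+ 2)%:E <= C%:E)%E.
Proof.
have [N [mN N0 cN]] := cvg_terminal.
have mX2 (n : nat) : measurable_fun setT (fun w => (X n%:R w ^+ 2)%:E).
  by apply/measurable_EFinP; apply: measurable_funX; exact: mX.
have p2 (n : nat) w : setT w -> (0 <= (X n%:R w ^+ 2)%:E)%E by rewrite lee_fin sqr_ge0.
have := fatou P measurableT mX2 p2.
have -> : (\int[P]_w limn_einf (fun n => (X n%:R w ^+ 2)%:E) =
           \int[P]_w ((terminal X w) ^+ 2)%:E)%E.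
  apply: ae_eq_integral => //.
  - rewrite /limn_einf; apply: measurableT_comp => //.
    by apply: measurable_fun_limn_esup => n; exact: measurableT_comp.
  - by apply/measurable_EFinP; apply: measurable_funX; exact: terminal_measurable.
  exists N; split=> // w /= H; apply: contrapT => /cN cw; apply: H => _.
  have : (fun n => (X n%:R w ^+ 2)%:E) @ \oo --> ((terminal X w) ^+ 2)%:E.
    apply: cvg_EFin; first exact: nearW.
    by apply: (cvgM cw cw).
  by move/cvg_limn_einf_sup => -[].
move/le_trans; apply; rewrite limn_einf_lim; apply: lime_le; first exact: is_cvg_einfs.
apply: nearW => n; apply: (@le_trans _ _ (\int[P]_w (X n%:R w ^+ 2)%:E)%E); last exact: XC.
by apply: ereal_inf_lbound; exists n => /=.
Qed.

End terminal.
End convergence.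

(** * The past of an optional set's end *)

Section random_times.
Context (R : realType) d (T : measurableType d) (P : probability T R)
  (F : R -> set (set T)).
Hypothesis uF : usual_conditions P F.

Definition F_oo : set (set T) := <<s \bigcup_(t in [set t : R | 0 <= t]) F t >>.

Lemma F_oo_sigma : sigma_algebra setT F_oo.
Proof. exact: smallest_sigma_algebra. Qed.

Lemma F_sub_oo t : 0 <= t -> F t `<=` F_oo.
Proof. by move=> t0 A FA; apply: sub_sigma_algebra; exists t. Qed.

Lemma F_oo_sub : F_oo `<=` measurable.
Proof.
apply: smallest_sub; first exact: sigma_algebra_measurable.
by move=> A [t t0]; exact: (filtration_sub uF).
Qed.

Lemma cadlag_right (X : R -> T -> R) (w : T) (t : R) : cadlag X -> 0 <= t ->
  X s w @[s --> t^'+] --> X t w.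
Proof. by move=> cX t0; case: (cX w) => + _; exact. Qed.

Lemma measurable_at_random_time d' (S : measurableType d') (X : R -> S -> R) (tau : S -> R) :
  (forall (w : S) (t : R), 0 <= t -> X s w @[s --> t^'+] --> X t w) ->
  (forall t, 0 <= t -> measurable_fun setT (X t)) ->
  measurable_fun setT tau -> (forall w, 0 <= tau w) ->
  measurable_fun setT (fun w => X (tau w) w).
Proof.
move=> rX mX mtau tau0.
have := measurableT_comp (right_continuous_measurable rX mX)
  (measurable_fun_pair mtau (@measurable_id _ S setT)).
by congr measurable_fun; apply/funext => w /=; rewrite (max_idPr _).
Qed.

Section end_of_optional.
Variables (Gam : set (R * T)).
Hypothesis oG : optional_sigma_algebra F Gam.
Let L := end_of Gam.

Lemma end_of_ge0 w : (0 <= L w)%E.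
Proof. by rewrite /L /end_of le_max lexx. Qed.

Lemma end_of_gt w (q : R) : 0 <= q ->
  (q%:E < L w)%E <-> exists t, q < t /\ Gam (t, w).
Proof.
move=> q0; rewrite /L /end_of lt_max.
have -> /= : (q%:E < 0)%E = false by rewrite lte_fin ltNge q0.
split.
  by move=> /ereal_sup_gt[_ [t Gt <-]]; rewrite lte_fin; exists t.
by case=> t [qt Gt]; apply: (@lt_le_trans _ _ t%:E) => //; apply: ereal_sup_ubound; exists t.
Qed.

Lemma debut_lty w (q : R) : 0 <= q -> (debut Gam q w < +oo)%E <-> (q%:E < L w)%E.
Proof.
move=> q0; rewrite end_of_gt//; split=> [/ereal_inf_lt[_ [t [qt Gt] _] _]|[t Gt]]; first by exists t.
by apply: (@le_lt_trans _ _ t%:E); [apply: ereal_inf_lbound; exists t|rewrite ltry].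
Qed.

Lemma debut_le_end w (q : R) : 0 <= q -> (debut Gam q w < +oo)%E -> (debut Gam q w <= L w)%E.
Proof.
move=> q0 /ereal_inf_lt[_ [t [qt Gt] _] _]; apply: (@le_trans _ _ t%:E).
  by apply: ereal_inf_lbound; exists t.
by rewrite /L /end_of le_max; apply/orP; right; apply: ereal_sup_ubound; exists t.
Qed.

(** [L > q] exactly when the debut after [q] is finite. *)
Lemma end_of_measurable_oo : measurable_fun setT (L : g_sigma_algebraType F_oo -> \bar R).
Proof.
apply: (measurability _ (ErealGenOInfty.measurableE R)) => _ [_ [q ->] <-].
rewrite setTI (_ : _ @^-1` _ = [set w | (q%:E < L w)%E]); last first.
  by apply/seteqP; split=> w /=; rewrite in_itv/= andbT.
have [q0|q0] := leP 0 q; last first.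
  rewrite (_ : mkset _ = setT)//; apply/seteqP; split=> w // _ /=.
  by apply: lt_le_trans (end_of_ge0 w); rewrite lte_fin.
rewrite (_ : mkset _ = \bigcup_n [set w | (debut Gam q w < (n%:R)%:E)%E]).
  apply: bigcupT_measurable => n; rewrite g_measurableE; last exact: F_oo_sigma.
  by apply: (@F_sub_oo n%:R) => //; exact: (debut_lt_measurable uF).
apply/seteqP; split=> [w /= /(debut_lty w q0)|w [n _ /= dn]]; last first.
  by apply/(debut_lty w q0); apply: lt_trans dn _; rewrite ltry.
have := debut_ge Gam q w; case E : (debut Gam q w) => [r| |]// _ _.
by exists (Num.trunc `|r|).+1 => //; rewrite /= E lte_fin (le_lt_trans (ler_norm r))// truncnS_gt.
Qed.

(** An optional process at time [L] is pulled back from the optional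
sigma-algebra by the graph of [L], which is measurable for [F_oo]. *)
Lemma sigma_at_sub_oo : sigma_at F L `<=` F_oo.
Proof.
apply: smallest_sub; first exact: F_oo_sigma.
move=> _ [z oz [B mB <-]].
have mL : measurable_fun setT ((fine \o L) : g_sigma_algebraType F_oo -> R).
  by apply: measurableT_comp => //; exact: end_of_measurable_oo.
have L0 w : 0 <= fine (L w) by apply: fine_ge0; exact: end_of_ge0.
rewrite -(g_measurableE F_oo_sigma).
pose phi (w : g_sigma_algebraType F_oo) := (fine (L w), w : T).
rewrite (_ : _ `&` _ = phi @^-1` ([set p | 0 <= p.1] `&` (fun p => z p.1 p.2) @^-1` B)).
  apply: (@optional_preimage _ _ _ F) => [//|X aX cX|]; last by apply: oz; exists B.
  apply: (@measurable_at_random_time _ (g_sigma_algebraType F_oo)) => // [w t|t t0].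
    exact: cadlag_right.
  apply/(measurable_wrtP _ F_oo_sigma); apply: subset_trans (aX t t0) _; exact: F_sub_oo.
by apply/seteqP; split=> w /=; [case|case].
Qed.

End end_of_optional.

Lemma stopping_time_measurable (S : T -> \bar R) : stopping_time F S -> measurable_fun setT S.
Proof.
move=> [S0 mS]; apply: (measurability _ (ErealGenOInfty.measurableE R)) => _ [_ [q ->] <-].
rewrite setTI (_ : _ @^-1` _ = ~` [set w | (S w <= q%:E)%E]); last first.
  by apply/seteqP; split=> w /=; rewrite in_itv/= andbT ltNge => /negP.
apply: measurableC; have [q0|q0] := leP 0 q; first exact: (filtration_sub uF q0 (mS _ q0)).
rewrite (_ : mkset _ = set0)//; apply/seteqP; split=> w //= Sq.
by have := le_trans (S0 w) Sq; rewrite lee_fin leNgt q0.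
Qed.

(** [X_S] is measurable for [F_(S+)]: on [S < t], it is the progressive process
[X] read at the time [min(S, t)], which is measurable for [F t]. *)
Lemma stopped_measurable (S : T -> \bar R) (X : R -> T -> R) (B : set R) t :
  (forall w, (0 <= S w)%E) -> (forall t, 0 <= t -> F t [set w | (S w < t%:E)%E]) ->
  adapted F X -> cadlag X -> measurable B -> 0 <= t ->
  F t (at_time X S @^-1` B `&` [set w | (S w < t%:E)%E]).
Proof.
move=> S0 mS aX cX mB t0; have sF := filtration_sigma uF t0.
pose G := g_sigma_algebraType (F t).
pose tau (w : G) := fine (mine (S w) t%:E).
have tau0 w : 0 <= tau w by apply: fine_ge0; rewrite le_min S0 lee_fin.
have mtau : measurable_fun setT tau.
  apply: measurableT_comp => //.
  apply: (measurability _ (ErealGenInftyO.measurableE R)) => _ [_ [q ->] <-].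
  rewrite setTI g_measurableE// (_ : _ @^-1` _ = [set w | (mine (S w) t%:E < q%:E)%E]); last first.
    by apply/seteqP; split=> w /=; rewrite in_itv.
  have [qt|qt] := ltP t q.
    rewrite (_ : mkset _ = setT); first by rewrite -(g_measurableE sF); exact: measurableT.
    by apply/seteqP; split=> w //= _; rewrite gt_min lte_fin qt orbT.
  rewrite (_ : mkset _ = [set w | (S w < q%:E)%E]); last first.
    have tq : (t%:E < q%:E)%E = false by rewrite lte_fin ltNge qt.
    by apply/seteqP; split=> w /=; rewrite gt_min tq orbF.
  have [q0|q0] := leP 0 q; first by apply: (filtration_le uF q0 qt); exact: mS.
  rewrite (_ : mkset _ = set0); first by case: sF.
  apply/seteqP; split=> w //= Sq.
  by have := le_lt_trans (S0 w) Sq; rewrite lte_fin ltNge ltW.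
have mh := measurableT_comp (adapted_progressive uF t0 aX cX)
  (measurable_fun_pair mtau (@measurable_id _ G setT)).
have := mh measurableT B mB; rewrite setTI => mhB.
rewrite -(g_measurableE sF).
rewrite (_ : _ `&` _ = ((fun w : G => X (Num.max 0 (Num.min (tau w) t)) w) @^-1` B) `&`
    [set w | (S w < t%:E)%E]).
  by apply: measurableI; [exact: mhB|rewrite g_measurableE//; exact: mS].
have tauE w : (S w < t%:E)%E -> Num.max 0 (Num.min (tau w) t) = fine (S w).
  move=> Sw; have fS : S w \is a fin_num.
    by rewrite ge0_fin_numE//; apply: lt_trans Sw _; rewrite ltry.
  rewrite /tau (min_idPl (ltW Sw)) (min_idPl _); first by rewrite (max_idPr _)// fine_ge0.
  by rewrite -lee_fin fineK// ltW.
by apply/seteqP; split=> w [/= Bw Sw]; split=> //; move: Bw; rewrite /at_time tauE.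
Qed.

End random_times.

(** * Optional stopping *)

Section optional_stopping.
Context (R : realType) d (T : measurableType d) (P : probability T R)
  (F : R -> set (set T)).
Hypothesis uF : usual_conditions P F.
Variables (X : R -> T -> R) (C : R).
Hypothesis mgX : martingale P F X.
Hypothesis XC : forall t : R, 0 <= t -> (\int[P]_w ((X t w) ^+ 2)%:E <= C%:E)%E.

Let fF : filtration F. Proof. by case: uF. Qed.
Let rcX (w : T) (t : R) : 0 <= t -> X s w @[s --> t^'+] --> X t w.
Proof. by move=> t0; apply: cadlag_right => //; case: mgX. Qed.
Let cX (s t : R) : 0 <= s -> s <= t -> is_condexp P (F s) (X t) (X s).
Proof. by case: mgX => _; apply. Qed.
Let mX (t : R) : 0 <= t -> measurable_fun setT (X t).
Proof. by move=> t0; case: (cX t0 (lexx t)) => /integrable_measurable_fun. Qed.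

Lemma usual_complete N : P.-negligible N -> measurable N.
Proof. by move=> nN; apply: (filtration_sub uF (lexx 0)); exact: (filtration_negligible uF). Qed.

Let Pc := usual_complete.

Lemma at_time_measurable (S : T -> \bar R) : measurable_fun setT S -> (forall w, (0 <= S w)%E) ->
  measurable_fun setT (at_time X S).
Proof.
move=> mS S0; apply: (measurable_at_random_time (tau := fine \o S)) => //.
- by apply: measurableT_comp.
- by move=> w; exact: fine_ge0.
Qed.

Lemma at_time_integrable (S : T -> \bar R) : measurable_fun setT S -> (forall w, (0 <= S w)%E) ->
  P.-integrable setT (EFin \o at_time X S).
Proof.
move=> mS S0; apply: (@le_integrable _ _ _ P _ measurableT _ (running_sup X)).
- by apply/measurable_EFinP; exact: at_time_measurable.
- move=> w _ /=; rewrite (gee0_abs (running_sup_ge0 X w)).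
  by apply: running_sup_ub; exact: fine_ge0.
- exact: (running_sup_integrable fF rcX cX XC).
Qed.

(** The hypothesis on [A] says that it is an event of [F_(S+)]. The time [S] is
approximated from the right by times of the grid of mesh [1/(n+1)]; on the event
where the approximation takes a given value, the martingale is closed by its
limit. The running supremum dominates. *)
Lemma optional_stopping (S : T -> \bar R) (A : set T) :
  stopping_time F S ->
  (forall t, 0 <= t -> F t (A `&` [set w | (S w < t%:E)%E])) ->
  let D := A `&` [set w | (S w < +oo)%E] in
  measurable D /\
  (\int[P]_(w in D) (at_time X S w)%:E = \int[P]_(w in D) (terminal X w)%:E)%E.
Proof.
move=> sS AS D; have [S0 _] := sS; have mS := stopping_time_measurable uF sS.
have fS w : (S w < +oo)%E -> S w = (fine (S w))%:E.
  by move=> Sw; rewrite fineK// ge0_fin_numE.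
have fS0 w : 0 <= fine (S w) by exact: fine_ge0.
have Fm (t : R) : 0 <= t -> F t `<=` measurable by exact: (filtration_sub uF).
have DE : D = \bigcup_n (A `&` [set w | (S w < (n%:R)%:E)%E]).
  apply/seteqP; split=> [w [Aw /= /fS Sw]|w [n _ [Aw /= Sw]]]; last first.
    by split=> //=; apply: lt_trans Sw _; rewrite ltry.
  exists (Num.trunc (fine (S w))).+1 => //; split=> //=; rewrite Sw lte_fin; exact: truncnS_gt.
have mD : measurable D.
  by rewrite DE; apply: bigcupT_measurable => n; apply: (Fm n%:R) => //; exact: AS.
split => //.
pose k n w := Num.trunc (n.+1%:R * fine (S w)).
pose Y n w := X ((k n w).+1%:R / n.+1%:R) w.
have phi0 n i : 0 <= i.+1%:R / n.+1%:R :> R by rewrite divr_ge0.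
have mY n : measurable_fun setT (Y n).
  have mg : measurable_fun setT (fun p : R * T =>
      X ((fun i => i.+1%:R / n.+1%:R) (Num.trunc ((fun s => n.+1%:R * Num.max 0 s) p.1))) p.2).
    apply: (@measurable_grid _ _ _ X (fun i => i.+1%:R / n.+1%:R)
      (fun s => n.+1%:R * Num.max 0 s)) => [i|//|s]; first exact: mX.
    - by apply: measurable_funM => //; exact: measurable_maxr.
    - by rewrite mulr_ge0// le_max lexx.
  have mfS : measurable_fun setT (fine \o S) by exact: measurableT_comp.
  have := measurableT_comp mg (measurable_fun_pair mfS (@measurable_id _ T setT)).
  by congr measurable_fun; apply/funext => w /=; rewrite (max_idPr _).
have Yle n w : (`|(Y n w)%:E| <= running_sup X w)%E by apply: running_sup_ub.
have isup := running_sup_integrable fF rcX cX XC.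
have iY n : P.-integrable setT (EFin \o Y n).
  apply: (@le_integrable _ _ _ P _ measurableT _ (running_sup X)) => //.
    exact/measurable_EFinP.
  by move=> w _ /=; rewrite (gee0_abs (running_sup_ge0 X w)); exact: Yle.
have iterm := terminal_integrable fF rcX cX XC Pc.
have YE n : (\int[P]_(w in D) (Y n w)%:E = \int[P]_(w in D) (terminal X w)%:E)%E.
  pose Dk i := D `&` [set w | k n w = i].
  have n0 : 0 < n.+1%:R :> R by [].
  have DkE i : Dk i = (A `&` [set w | (S w < (i.+1%:R / n.+1%:R)%:E)%E]) `\`
                      (A `&` [set w | (S w < (i%:R / n.+1%:R)%:E)%E]).
    apply/seteqP; split=> [w [[Aw /= /fS Sw] kw]|w [[Aw /= Sw] /not_andP[//|/negP]]].
      have /andP[] := truncn_itv (mulr_ge0 (ltW n0) (fS0 w)).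
      rewrite -/(k n w) kw => k1 k2; split.
        by split=> //=; rewrite Sw lte_fin ltr_pdivlMr// mulrC.
      move=> [_ /=]; rewrite Sw lte_fin ltr_pdivlMr// mulrC.
      by move=> /(le_lt_trans k1); rewrite ltxx.
    rewrite -leNgt => Sw'; have Swoo : (S w < +oo)%E by apply: lt_trans Sw _; rewrite ltry.
    split=> //=; move: Sw Sw'; rewrite (fS _ Swoo) lte_fin lee_fin => h1 h2.
    apply: truncn_def; rewrite mulrC -ler_pdivrMr// h2/=.
    by rewrite -ltr_pdivlMr.
  have FDk i : F (i.+1%:R / n.+1%:R) (Dk i).
    have sF := filtration_sigma uF (phi0 n i).
    rewrite DkE -(g_measurableE sF); apply: measurableD; rewrite g_measurableE//; first exact: AS.
    have i0 : 0 <= i%:R / n.+1%:R :> R by rewrite divr_ge0.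
    apply: (filtration_le uF i0 _ (AS _ i0)).
    by rewrite ler_wpM2r ?invr_ge0// ler_nat.
  have DU : D = \bigcup_i Dk i.
    by apply/seteqP; split=> [w Dw|w [i _ []//]]; exists (k n w).
  have tDk : trivIset setT Dk.
    apply/trivIsetP => i j _ _ /eqP ij; apply/seteqP; split=> w //= [[_ wi] [_ wj]].
    by apply: ij; rewrite -wi -wj.
  have mDk i : measurable (Dk i) := Fm _ (phi0 n i) _ (FDk i).
  have iU (f : T -> R) : P.-integrable setT (EFin \o f) -> P.-integrable (\bigcup_i Dk i) (EFin \o f).
    by apply: integrableS => //; exact: bigcupT_measurable.
  rewrite DU (integral_bigcup tDk mDk (iU _ (iY n))) (integral_bigcup tDk mDk (iU _ iterm)).
  apply: eq_eseriesr => i _.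
  rewrite (terminal_closes fF rcX cX XC Pc (phi0 n i) (FDk i)).
  by apply: eq_integral => w; rewrite inE => -[_ /= kw]; rewrite /Y kw.
have [] := @dominated_convergence _ _ _ P D mD (fun n w => (Y n w)%:E) (EFin \o at_time X S) (running_sup X).
- by move=> n; apply/measurable_EFinP; apply: measurable_funTS; exact: mY.
- by apply/measurable_EFinP; apply: measurable_funTS; exact: at_time_measurable.
- apply: aeW => w [_ /= Sw]; apply: cvg_EFin; first exact: nearW.
  have /cvg_at_rightP := @rcX w (fine (S w)) (fS0 w); apply; split.
    move=> n; rewrite ltr_pdivlMr// mulrC.
    by have /andP[] := truncn_itv (mulr_ge0 (ler0n R n.+1) (fS0 w)).
  apply: (@squeeze_cvgr _ _ _ _ (fun=> fine (S w)) (fun n => fine (S w) + n.+1%:R^-1)).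
  + apply: nearW => n; have /andP[k1 k2] := truncn_itv (mulr_ge0 (ler0n R n.+1) (fS0 w)).
    apply/andP; split; first by rewrite ler_pdivlMr// mulrC; exact: ltW.
    rewrite ler_pdivrMr// mulrDl mulVf// -natr1 lerD2r.
    by rewrite [leRHS]mulrC.
  + exact: cvg_cst.
  + rewrite -[X in _ --> X]addr0; apply: cvgD; [exact: cvg_cst|exact: cvg_harmonic].
- exact: integrableS isup.
- by apply: aeW => w n _; exact: Yle.
move=> _ _; rewrite (_ : [sequence _]_n = fun=> (\int[P]_(w in D) (terminal X w)%:E)%E); last first.
  by apply/funext => n /=; exact: YE.
move=> cY; rewrite -(cvg_lim _ cY)//; exact: lim_cst.
Qed.

End optional_stopping.

(** * Vanishing at the end of an optional set *)

Section null_integrals.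
Context (R : realType) d (T : measurableType d) (P : probability T R).

(** The factor [s] treats positive and negative functions together. *)
Lemma integral_pm_null (f : T -> R) (s : R) D : measurable D -> P.-integrable setT (EFin \o f) ->
  (forall w, D w -> 0 < s * f w) -> (\int[P]_(w in D) (f w)%:E = 0)%E -> P D = 0%E.
Proof.
move=> mD fi fD f0; have [iD sD] := integral_affine s 0 mD fi.
have mf : measurable_fun D (fun w => (s * f w + 0)%:E) by case/integrableP: iD.
have : (\int[P]_(w in D) `|(s * f w + 0)%:E| = 0)%E.
  rewrite -[RHS](mule0 s%:E) -f0 -[RHS]adde0 -[X in (_ = _ + X)%E](mul0e (P D)) -sD.
  by apply: eq_integral => w; rewrite inE => /fD H; rewrite abse_EFin addr0 gtr0_norm.
move=> /(ae_eq_integral_abs P mD mf) [N [mN N0 DN]].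
apply/eqP; rewrite eq_le measure_ge0 andbT -N0; apply: le_measure; rewrite ?inE//.
move=> w Dw; apply: DN => /= /(_ Dw) [] H; have := fD _ Dw.
by rewrite -[s * f w]addr0 H ltxx.
Qed.

Lemma integral_eq0_sub (f : T -> R) A B : measurable A -> measurable B -> A `<=` B ->
  P.-integrable setT (EFin \o f) -> P.-negligible (B `\` A) ->
  (\int[P]_(w in A) (f w)%:E = \int[P]_(w in B) (f w)%:E)%E.
Proof.
move=> mA mB AB fi nBA; have mBA : measurable (B `\` A) by exact: measurableD.
have fB : P.-integrable B (EFin \o f) by exact: integrableS fi.
have := negligible_integral mBA mB fB (measure_negligible mBA nBA).
by rewrite setDD (setIidr AB) => ->.
Qed.

Lemma integral0_generated (G : set (set T)) (f : T -> R) :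
  G `<=` measurable -> G setT -> setI_closed G -> P.-integrable setT (EFin \o f) ->
  (forall A, G A -> (\int[P]_(w in A) (f w)%:E = 0)%E) ->
  forall A, <<s G >> A -> (\int[P]_(w in A) (f w)%:E = 0)%E.
Proof.
move=> Gm GT GI fi Gf.
pose H := [set A | measurable A /\ (\int[P]_(w in A) (f w)%:E = 0)%E].
suff GH : <<s G >> `<=` H by move=> A /GH [].
apply: lambda_system_subset => //; last by move=> A GA; split; [exact: Gm|exact: Gf].
apply/dynkin_lambda_system; split.
- by split => //; exact: Gf.
- move=> A [mA A0]; have mC := measurableC mA; split => //.
  have := Gf _ GT; rewrite -[X in (\int[_]_(_ in X) _)%E](setUv A) integral_setU//.
  + by rewrite A0 add0e.
  + by rewrite setUv; case/integrableP : fi.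
  + by apply/disj_setPS; rewrite setICr.
- move=> A tA HA; have mA k : measurable (A k) by case: (HA k).
  split; first exact: bigcupT_measurable.
  rewrite integral_bigcup//; last by apply: integrableS fi => //; exact: bigcupT_measurable.
  by apply: eseries0 => k _ _; case: (HA k).
Qed.

End null_integrals.

Section vanishing.
Context (R : realType) d (T : measurableType d) (P : probability T R)
  (F : R -> set (set T)).
Hypothesis uF : usual_conditions P F.
Variables (X : R -> T -> R) (C : R) (Gam : set (R * T)).
Hypothesis mgX : martingale P F X.
Hypothesis XC : forall t : R, 0 <= t -> (\int[P]_w ((X t w) ^+ 2)%:E <= C%:E)%E.
Hypothesis oG : optional_sigma_algebra F Gam.
Let L := end_of Gam.
Hypothesis L0 : P [set w | L w = 0%E] = 0%E.
Hypothesis Loo : P [set w | L w = +oo%E] = 0%E.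
Hypothesis mL : measurable_fun setT L.
Hypothesis LA : avoids_stopping_times P F L.
Hypothesis X0 : forall A, sigma_at F L A -> (\int[P]_(w in A) (terminal X w)%:E = 0)%E.

Let fF : filtration F. Proof. by case: uF. Qed.
Let rcX (w : T) (t : R) : 0 <= t -> X s w @[s --> t^'+] --> X t w.
Proof. by move=> t0; apply: cadlag_right => //; case: mgX. Qed.
Let cX (s t : R) : 0 <= s -> s <= t -> is_condexp P (F s) (X t) (X s).
Proof. by case: mgX => _; apply. Qed.
Let aX : adapted F X.
Proof. by move=> t t0; case: (cX t0 (lexx t)). Qed.
Let clX : cadlag X. Proof. by case: mgX. Qed.

Lemma negligible_eq_stopping (S : T -> \bar R) : stopping_time F S ->
  P.-negligible [set w | L w = S w].
Proof.
move=> sS; apply/negligibleP; last exact: LA.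
have := measurable_eqe measurableT mL (stopping_time_measurable uF sS).
by rewrite setTI; apply.
Qed.

Lemma negligible_end_infty : P.-negligible [set w | L w = +oo%E].
Proof.
apply/negligibleP => //.
have := measurable_eqe measurableT mL (@measurable_cst _ _ _ _ setT (+oo%E : \bar R)).
by rewrite setTI; apply.
Qed.

Lemma negligible_end_zero : P.-negligible [set w | L w = 0%E].
Proof.
apply/negligibleP => //.
have := measurable_eqe measurableT mL (@measurable_cst _ _ _ _ setT (0%E : \bar R)).
by rewrite setTI; apply.
Qed.

(** The event is read at time [L] on the indicator of [A] after [S + e], an
adapted process whose paths are right-continuous because they jump exactly at
[S + e]. Letting [e] decrease to 0 recovers [A] on [S < L]. *)
Lemma sigma_at_after (S : T -> \bar R) A e : 0 < e -> stopping_time F S ->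
  (forall t, 0 <= t -> F t (A `&` [set w | (S w < t%:E)%E])) ->
  sigma_at F L [set w | [/\ A w, (S w + e%:E <= L w)%E & (L w < +oo)%E]].
Proof.
move=> e0 [S0 mS] AS.
pose z t : T -> R := \1_(A `&` [set w | (S w + e%:E <= t%:E)%E]).
have Fz t : 0 <= t -> F t (A `&` [set w | (S w + e%:E <= t%:E)%E]).
  move=> t0; have sF := filtration_sigma uF t0.
  have [et|te] := leP e t; last first.
    rewrite (_ : _ `&` _ = set0); first by case: sF.
    apply/seteqP; split=> w //= [_ H].
    have : (e%:E <= t%:E)%E by apply: le_trans H; rewrite leeDr.
    by rewrite lee_fin leNgt te.
  have te0 : 0 <= t - e by rewrite subr_ge0.
  rewrite (_ : _ `&` _ = (A `&` [set w | (S w < t%:E)%E]) `&` [set w | (S w <= (t - e)%:E)%E]).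
    rewrite -(g_measurableE sF); apply: measurableI; rewrite g_measurableE//; first exact: AS.
    by apply: (filtration_le uF te0 _ (mS _ te0)); rewrite gerBl ltW.
  apply/seteqP; split=> w /=; rewrite EFinB -leeBrDr//; last by case=> -[].
  move=> [Aw Sw]; split=> //; split=> //; apply: le_lt_trans Sw _.
  by rewrite -EFinB lte_fin gtrBl.
have az : adapted F z.
  move=> t t0; have sF := filtration_sigma uF t0.
  apply/(measurable_wrtP _ sF); apply: measurable_indic.
  by rewrite g_measurableE//; exact: Fz.
have zE t w : z t w = if `[< A w /\ (S w + e%:E <= t%:E)%E >] then 1 else 0.
  rewrite /z indicE; case: asboolP => H; first by rewrite mem_set.
  by rewrite memNset.
have cz : cadlag z.
  move=> w; have [Aw|nAw] := pselect (A w); last first.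
    have z0 t : z t w = 0 by rewrite zE; case: asboolP => // -[].
    split=> t t0.
      by rewrite z0; apply: cvg_near_cst; apply: nearW => s; exact: z0.
    by apply/cvg_ex; exists 0; apply: cvg_near_cst; apply: nearW => s; exact: z0.
  case Sw : (S w) => [r| |]; last 2 first.
  - have z0 t : z t w = 0 by rewrite zE; case: asboolP => // -[_]; rewrite Sw.
    split=> t t0.
      by rewrite z0; apply: cvg_near_cst; apply: nearW => s; exact: z0.
    by apply/cvg_ex; exists 0; apply: cvg_near_cst; apply: nearW => s; exact: z0.
  - by have := S0 w; rewrite Sw.
  have z1 t : r + e <= t -> z t w = 1.
    by move=> H; rewrite zE; case: asboolP => // -[]; rewrite Sw lee_fin.
  have z0 t : t < r + e -> z t w = 0.
    by move=> H; rewrite zE; case: asboolP => // -[_]; rewrite Sw lee_fin leNgt H.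
  split=> t t0.
    have [h|h] := leP (r + e) t.
      rewrite (z1 _ h); apply: cvg_near_cst; near=> s; apply: z1; apply: (le_trans h).
      by apply: ltW; near: s; exact: nbhs_right_gt.
    rewrite (z0 _ h); apply: cvg_near_cst; near=> s; apply: z0.
    by near: s; exact: nbhs_right_lt.
  apply/cvg_ex; have [h|h] := leP t (r + e).
    exists 0; apply: cvg_near_cst; near=> s; apply: z0; apply: lt_le_trans h.
    by near: s; exact: nbhs_left_lt.
  exists 1; apply: cvg_near_cst; near=> s; apply: z1; apply: ltW.
  by near: s; exact: nbhs_left_gt.
have oz : optional_process F z.
  by move=> B [D mD <-]; apply: sub_sigma_algebra; exists z => //; exists D.
rewrite (_ : mkset _ = setT `&` at_time z L @^-1` [set 1]).
  apply: sub_sigma_algebra; exists z => //; exists [set 1] => //; exact: measurable_set1.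
rewrite setTI; apply/seteqP; split=> w /=; rewrite /at_time zE.
  move=> [Aw SL Ly]; case: asboolP => // -[]; split=> //.
  by rewrite fineK// ge0_fin_numE//; exact: end_of_ge0.
case: asboolP => [[Aw SL] _|_ /eqP]; last by rewrite eq_sym oner_eq0.
move: SL; have := end_of_ge0 Gam w; rewrite -/L; case: (L w) => [l| |]//= _ SL.
  by split=> //; rewrite ltry.
exfalso; have : (e%:E <= 0)%E by apply: le_trans SL; rewrite leeDr.
by rewrite lee_fin leNgt e0.
Unshelve. all: by end_near.
Qed.

(** The events [0 < X_S] and [X_S < 0], for [S] the debut after [q], are in
[F_(S+)]. On each of them, [X_S] and the limit of [X] have the same integral, and
it is 0 since [S < L] almost surely where [S] is finite. *)
Lemma vanishes_at_debut q : 0 <= q ->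
  P.-negligible [set w | (debut Gam q w < +oo)%E /\ at_time X (debut Gam q) w <> 0].
Proof.
move=> q0; pose S := debut Gam q.
have sS : stopping_time F S by exact: (debut_stopping_time uF).
have mSlt t : 0 <= t -> F t [set w | (S w < t%:E)%E] by exact: (debut_lt_measurable uF).
have [S0 _] := sS; have mS := stopping_time_measurable uF sS.
have key (s : R) : P.-negligible ([set w | 0 < s * at_time X S w] `&` [set w | (S w < +oo)%E]).
  set A := [set w | 0 < s * at_time X S w].
  have AS t : 0 <= t -> F t (A `&` [set w | (S w < t%:E)%E]).
    move=> t0.
    have mB : measurable [set x : R | 0 < s * x].
      rewrite -[X in measurable X]setTI (_ : mkset _ = (fun x => s * x) @^-1` `]0, +oo[).
        have : measurable_fun setT (fun x : R => s * x) by exact: measurable_funM.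
        by apply => //; exact: measurable_itv.
      by apply/seteqP; split=> x /=; rewrite in_itv/= andbT.
    exact: (stopped_measurable uF S0 mSlt aX clX mB t0).
  have [mD DE] := optional_stopping uF mgX XC sS AS.
  set D := A `&` _ in mD DE *.
  pose E n := [set w | [/\ A w, (S w + (n.+1%:R^-1)%:E <= L w)%E & (L w < +oo)%E]].
  have sE n : sigma_at F L (E n) by apply: sigma_at_after => //; rewrite invr_gt0.
  have sU : sigma_at F L (\bigcup_n E n) by exact: sigma_algebra_bigcup.
  have mU : measurable (\bigcup_n E n).
    exact: (F_oo_sub uF (sigma_at_sub_oo uF oG sU)).
  have UD : \bigcup_n E n `<=` D.
    move=> w [n _ [Aw SL Ly]]; split=> //=; apply: le_lt_trans Ly; apply: le_trans SL.
    by rewrite leeDl// lee_fin invr_ge0.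
  have iterm := terminal_integrable fF rcX cX XC (usual_complete uF).
  apply/negligibleP => //; apply: (@integral_pm_null _ _ _ _ (at_time X S) s) => //.
  - exact: (at_time_integrable uF mgX XC).
  - by move=> w [].
  - rewrite DE -(integral_eq0_sub mU mD UD iterm) ?X0//.
    apply: negligibleS (negligibleU (negligible_eq_stopping sS) negligible_end_infty).
    move=> w [[Aw /= Sy] nU]; apply: contrapT => /not_orP[LS Ly]; apply: nU.
    have SL : (S w <= L w)%E by exact: debut_le_end.
    have {}Ly : (L w < +oo)%E by rewrite ltey; apply/eqP.
    have fS : S w \is a fin_num by rewrite ge0_fin_numE.
    have fL : L w \is a fin_num by rewrite ge0_fin_numE// end_of_ge0.
    have lt : fine (S w) < fine (L w).
      rewrite -lte_fin !fineK// lt_neqAle SL andbT; apply/eqP => H; exact/LS.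
    pose g := fine (L w) - fine (S w); have g0 : 0 < g by rewrite subr_gt0.
    exists (Num.trunc g^-1) => //; split=> //.
    rewrite -(fineK fS) -(fineK fL) -EFinD lee_fin -lerBrDl -/g.
    rewrite -[leRHS]invrK lef_pV2 ?posrE ?invr_gt0//; apply: ltW; exact: truncnS_gt.
apply: negligibleS (negligibleU (key 1) (key (-1))) => w [/= Sy /eqP XS].
have [h|h|h] := ltgtP 0 (at_time X S w).
- by left; split=> //=; rewrite mul1r.
- by right; split=> //=; rewrite mulN1r oppr_gt0.
- by rewrite -h eqxx in XS.
Qed.

Let rtime n : R := if @unpickle rat n is Some r then `|ratr r| else 0.

Let rtime_ge0 n : 0 <= rtime n. Proof. by rewrite /rtime; case: unpickle. Qed.

Let rtime_dense (a b : R) : 0 <= a -> a < b -> exists n, a < rtime n < b.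
Proof.
move=> a0 /rat_in_itvoo[r]; rewrite in_itv/= => /andP[ar rb].
exists (pickle r); rewrite /rtime pickleK ger0_norm ?ar//.
by apply: ltW; exact: le_lt_trans ar.
Qed.

Lemma exceed_optional (lam : R) : optional_sigma_algebra F [set p | 0 <= p.1 /\ lam < `|X p.1 p.2|].
Proof.
apply: sub_sigma_algebra; exists X; first by split.
exists [set x | lam < `|x|].
  rewrite /borel -[X in measurable X]setTI (_ : mkset _ = (fun x => `|x|) @^-1` `]lam, +oo[).
    have : measurable_fun setT (fun x : R => `|x|) by exact: measurableT_comp.
    by apply => //; exact: measurable_itv.
  by apply/seteqP; split=> x /=; rewrite in_itv/= andbT.
by apply/seteqP; split.
Qed.

(** The debuts after rational times are zeros of [X] that accumulate at [L] from
the left, so the left limit of [X] at [L] is 0. A value of modulus greater than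
[1/(j+1)] at [L] would make [L] the debut, after some rational time, of the
optional set where [X] has such a modulus. *)
Theorem vanishes_at_end : P.-negligible [set w | at_time X L w <> 0].
Proof.
pose S n j := debut [set p | 0 <= p.1 /\ j.+1%:R^-1 < `|X p.1 p.2|] (rtime n).
have sS n j : stopping_time F (S n j).
  by apply: (debut_stopping_time uF) => //; exact: exceed_optional.
pose Z := [set w | L w = 0%E] `|` ([set w | L w = +oo%E] `|`
  (\bigcup_n [set w | L w = debut Gam (rtime n) w] `|`
  (\bigcup_n [set w | (debut Gam (rtime n) w < +oo)%E /\ at_time X (debut Gam (rtime n)) w <> 0] `|`
   \bigcup_n \bigcup_j [set w | L w = S n j w]))).
have nZ : P.-negligible Z.
  apply: negligibleU; first exact: negligible_end_zero.
  apply: negligibleU; first exact: negligible_end_infty.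
  apply: negligibleU.
    apply: negligible_bigcup => n; apply: negligible_eq_stopping.
    exact: (debut_stopping_time uF).
  apply: negligibleU; first by apply: negligible_bigcup => n; exact: vanishes_at_debut.
  by apply: negligible_bigcup => n; apply: negligible_bigcup => j; exact: negligible_eq_stopping.
apply: negligibleS nZ => w XL; apply: contrapT.
move=> /not_orP[w0 /not_orP[woo /not_orP[wd /not_orP[wX wS]]]].
have Lge0 := end_of_ge0 Gam w.
have [l lE] : exists l, L w = l%:E.
  move: woo Lge0; rewrite /= /L; case: (end_of Gam w) => [l| |]//; by exists l.
have l0 : 0 < l.
  rewrite -lte_fin -lE lt_neqAle Lge0 andbT; apply/eqP => H; exact/w0.
have {XL} Xl : X l w <> 0 by move: XL; rewrite /= /at_time lE.
have dq n : rtime n < l -> exists s, [/\ rtime n <= s, s < l & X s w = 0].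
  move=> nl; have dy : (debut Gam (rtime n) w < +oo)%E.
    by apply/(debut_lty _ w (rtime_ge0 n)); rewrite -/L lE lte_fin.
  have dl := debut_le_end (rtime_ge0 n) dy; have dn := debut_ge Gam (rtime n) w.
  have dL : debut Gam (rtime n) w <> l%:E.
    by move=> H; apply: wd; exists n => //=; rewrite H.
  have dX : at_time X (debut Gam (rtime n)) w = 0.
    by apply: contrapT => H; apply: wX; exists n.
  move: dy dl dn dL dX; rewrite /at_time -/L lE.
  case: (debut Gam (rtime n) w) => [s| |]//= _; rewrite !lee_fin => sl ns sl' Xs.
  exists s; split=> //; rewrite lt_neqAle sl andbT; apply/eqP => H; by apply: sl'; rewrite H.
have [_ /(_ l l0)/cvg_ex[m cm]] := clX w.
have near_left e : 0 < e -> exists n, rtime n < l /\ forall s, rtime n <= s -> s < l -> `|m - X s w| < e.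
  move=> e0; have /cvgrPdist_lt/(_ e e0) := cm; rewrite /at_left => -[r /= r0 Hr].
  have [n /andP[n1 n2]] : exists n, Num.max 0 (l - r) < rtime n < l.
    by apply: rtime_dense; rewrite ?le_max ?lexx// gt_max l0 gtrBl.
  exists n; split=> // s ns sl; apply: Hr => //=.
  rewrite gtr0_norm ?subr_gt0//; move: n1; rewrite gt_max => /andP[_ n1].
  by rewrite ltrBlDr -ltrBlDl; exact: lt_le_trans ns.
have m0 : m = 0.
  apply/eqP; rewrite -normr_le0; apply/ler_addgt0Pr => e e0; rewrite add0r.
  have [n [nl Hn]] := near_left _ e0; have [s [ns sl Xs]] := dq _ nl.
  by have := Hn s ns sl; rewrite Xs subr0; exact: ltW.
pose j := Num.trunc `|X l w|^-1.
have Xl0 : 0 < `|X l w| by rewrite normr_gt0; apply/eqP.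
have jX : j.+1%:R^-1 < `|X l w|.
  by rewrite -[ltRHS]invrK ltf_pV2 ?posrE ?invr_gt0//; exact: truncnS_gt.
have j0 : 0 < j.+1%:R^-1 :> R by rewrite invr_gt0.
have [n [nl Hn]] := near_left _ j0.
apply: wS; exists n => //; exists j => //=; rewrite lE; apply/eqP; rewrite eq_le; apply/andP; split.
  apply: le_ereal_inf_tmp => _ [s [ns [_ Xs]] <-]; rewrite lee_fin leNgt; apply/negP => sl.
  by have := Hn s (ltW ns) sl; rewrite m0 sub0r normrN => /(lt_trans Xs); rewrite ltxx.
by apply: ereal_inf_lbound; exists l => //; split=> //; split=> //; exact: ltW.
Qed.

End vanishing.

(** * The martingale [M - K] *)

Lemma L2_boundedP (R : realType) d (T : measurableType d) (P : probability T R) (M : R -> T -> R) :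
  L2_bounded P M -> exists C : R, forall t, 0 <= t -> (\int[P]_w ((M t w) ^+ 2)%:E <= C%:E)%E.
Proof.
rewrite /L2_bounded; set U := [set _ | _ in _] => Uoo.
have MU t : 0 <= t -> (\int[P]_w ((M t w) ^+ 2)%:E <= ereal_sup U)%E.
  by move=> t0; apply: ereal_sup_ubound; exists t.
have U0 : (0 <= ereal_sup U)%E.
  by apply: le_trans (MU 0 (lexx 0)); apply: integral_ge0 => w _; rewrite lee_fin sqr_ge0.
by exists (fine (ereal_sup U)) => t t0; rewrite fineK ?ge0_fin_numE//; exact: MU.
Qed.

Lemma L2_bound_sub (R : realType) d (T : measurableType d) (P : probability T R) (X Y : T -> R) (C D : R) :
  measurable_fun setT X -> measurable_fun setT Y ->
  (\int[P]_w ((X w) ^+ 2)%:E <= C%:E)%E -> (\int[P]_w ((Y w) ^+ 2)%:E <= D%:E)%E ->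
  (\int[P]_w ((X w - Y w) ^+ 2)%:E <= (2 * C + 2 * D)%:E)%E.
Proof.
move=> mX mY XC YD.
have m2 (U : T -> R) : measurable_fun setT U -> measurable_fun setT (fun w => (2 * U w ^+ 2)%:E).
  by move=> mU; apply/measurable_EFinP; apply: measurable_funM => //; exact: measurable_funX.
have p2 (U : T -> R) w : setT w -> (0 <= (2 * U w ^+ 2)%:E)%E.
  by move=> _; rewrite lee_fin mulr_ge0// sqr_ge0.
apply: (@le_trans _ _ (\int[P]_w ((2 * X w ^+ 2)%:E + (2 * Y w ^+ 2)%:E))%E).
  apply: ge0_le_integral => //.
  - by move=> w _; rewrite lee_fin sqr_ge0.
  - by apply/measurable_EFinP; apply: measurable_funX; exact: measurable_funB.
  - by apply: emeasurable_funD; exact: m2.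
  - move=> w _; rewrite -EFinD lee_fin -subr_ge0 (_ : _ - _ = (X w + Y w) ^+ 2); last by ring.
    exact: sqr_ge0.
rewrite ge0_integralD//; [|exact: p2|exact: m2|exact: p2|exact: m2].
have sclI (U : T -> R) : measurable_fun setT U ->
    (\int[P]_w (2 * U w ^+ 2)%:E = 2%:E * \int[P]_w (U w ^+ 2)%:E)%E.
  move=> mU; under eq_integral do rewrite EFinM.
  rewrite ge0_integralZl//; first by apply/measurable_EFinP; exact: measurable_funX.
  by move=> w _; rewrite lee_fin sqr_ge0.
have -> : (2 * C + 2 * D)%:E = (2%:E * C%:E + 2%:E * D%:E)%E by [].
by rewrite !sclI//; apply: leeD; apply: lee_wpmul2l; rewrite ?lee_fin.
Qed.

Theorem corollary4p8 (R : realType) (d : measure_display)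
    (T : measurableType d) (P : probability T R)
    (F : R -> set (set T)) (L : T -> \bar R)
    (M K : R -> T -> R) (ML : T -> R) :
  usual_conditions P F ->
  honest_time P F L ->
  avoids_stopping_times P F L ->
  martingale P F M ->
  L2_bounded P M ->
  is_condexp P (sigma_at F L) (terminal M) ML ->
  cadlag K ->
  (forall t, 0 <= t -> is_condexp P (F t) ML (K t)) ->
  S2 P F L (fun t w => M t w - K t w).
Proof.
move=> uF [mL [Gam oG LE] L0 Loo] LA mgM /L2_boundedP[C MC] cML clK cK.
subst L; set L := end_of Gam in mL L0 Loo LA cML *.
have fF : filtration F by case: uF.
have sF (t : R) : 0 <= t -> sigma_algebra setT (F t) by exact: (filtration_sigma uF).
have Fm (t : R) : 0 <= t -> F t `<=` measurable by exact: (filtration_sub uF).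
have Fle (s t : R) : 0 <= s -> s <= t -> F s `<=` F t by exact: (filtration_le uF).
have Pc := usual_complete uF.
have [clM cM] := mgM.
have rcM (w : T) (t : R) : 0 <= t -> M s w @[s --> t^'+] --> M t w by exact: cadlag_right.
have sL : sigma_algebra setT (sigma_at F L) by exact: smallest_sigma_algebra.
have FLoo : sigma_at F L `<=` F_oo F by exact: (sigma_at_sub_oo uF oG).
have FLm : sigma_at F L `<=` measurable by apply: subset_trans FLoo (F_oo_sub uF).
have sT (G : set (set T)) : sigma_algebra setT G -> G setT.
  by move=> sG; rewrite -(g_measurableE sG); exact: measurableT.
have itM := terminal_integrable fF rcM cM MC Pc.
have [_ iML _ EML] := cML.
have MLC : (\int[P]_w ((ML w) ^+ 2)%:E <= C%:E)%E.
  apply: le_trans (condexp_sq_le sL FLm cML (sT _ sL)) _.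
  exact: (terminal_sq_le fF rcM cM MC Pc).
have KC (t : R) : 0 <= t -> (\int[P]_w ((K t w) ^+ 2)%:E <= C%:E)%E.
  move=> t0; apply: le_trans MLC.
  exact: (condexp_sq_le (sF t t0) (Fm t t0) (cK t t0) (sT _ (sF t t0))).
have cKK (s t : R) : 0 <= s -> s <= t -> is_condexp P (F s) (K t) (K s).
  move=> s0 st; have t0 := le_trans s0 st.
  have [_ iKs mKs EKs] := cK s s0; have [_ iKt _ EKt] := cK t t0.
  by split => // A FA; rewrite EKs// EKt//; exact: Fle FA.
pose N t w := M t w - K t w.
have cN (s t : R) : 0 <= s -> s <= t -> is_condexp P (F s) (N t) (N s).
  by move=> s0 st; apply: (condexpB (sF s s0) (Fm s s0)); [exact: cM|exact: cKK].
have clN : cadlag N.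
  move=> w; have [M1 M2] := clM w; have [K1 K2] := clK w; split=> t t0.
    by apply: cvgB; [exact: M1|exact: K1].
  by apply: is_cvgB; [exact: M2|exact: K2].
have mgN : martingale P F N by [].
have rcN (w : T) (t : R) : 0 <= t -> N s w @[s --> t^'+] --> N t w by exact: cadlag_right.
have NC (t : R) : 0 <= t -> (\int[P]_w ((N t w) ^+ 2)%:E <= (2 * C + 2 * C)%:E)%E.
  move=> t0; have [_ /integrable_measurable_fun mM _ _] := cM t t t0 (lexx t).
  have [_ /integrable_measurable_fun mK _ _] := cK t t0.
  by apply: L2_bound_sub => //; [exact: MC|exact: KC].
have itN := terminal_integrable fF rcN cN NC Pc.
have intB (U V : T -> R) A : measurable A -> P.-integrable setT (EFin \o U) ->
    P.-integrable setT (EFin \o V) ->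
    (\int[P]_(w in A) (U w - V w)%:E = \int[P]_(w in A) (U w)%:E - \int[P]_(w in A) (V w)%:E)%E.
  move=> mA iU iV; rewrite -integralB_EFin//; exact: integrableS measurableT mA _ _.
have intfin (U : T -> R) A : measurable A -> P.-integrable setT (EFin \o U) ->
    (\int[P]_(w in A) (U w)%:E)%E \is a fin_num.
  move=> mA iU; apply: integrable_fin_num => //; exact: integrableS measurableT mA _ _.
have iB (U V : T -> R) : P.-integrable setT (EFin \o U) -> P.-integrable setT (EFin \o V) ->
    P.-integrable setT (EFin \o (fun w => U w - V w)).
  by move=> iU iV; have := integrableB measurableT iU iV.
(* over an event of F t, both functions have the integral of N t *)
have diff0 A : F_oo F A -> (\int[P]_(w in A) (terminal N w - (terminal M w - ML w))%:E = 0)%E.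
  apply: integral0_generated.
  - by move=> B [t t0]; exact: Fm.
  - by exists 0 => //=; exact: (sT _ (sF 0 (lexx 0))).
  - move=> A1 A2 [s s0 A1s] [t t0 A2t]; have st0 : 0 <= Num.max s t by rewrite le_max s0.
    exists (Num.max s t) => //; rewrite -(g_measurableE (sF _ st0)).
    apply: measurableI; rewrite g_measurableE//; try exact: sF.
      by apply: (Fle s) A1s => //; rewrite le_max lexx.
    by apply: (Fle t) A2t => //; rewrite le_max lexx orbT.
  - by apply: (iB) => //; exact: iB.
  - move=> B [t t0 FB]; have mB := Fm _ t0 _ FB.
    have [iMt _ _ _] := cM t t t0 (lexx t); have [_ iKt _ EKt] := cK t t0.
    rewrite intB//; last exact: iB.
    rewrite (terminal_closes fF rcN cN NC Pc t0 FB) !intB//.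
    by rewrite (terminal_closes fF rcM cM MC Pc t0 FB) EKt// subee// fin_numB !intfin.
have tN0 A : sigma_at F L A -> (\int[P]_(w in A) (terminal N w)%:E = 0)%E.
  move=> LAA; have mA := FLm _ LAA; have := diff0 A (FLoo _ LAA).
  rewrite intB//; last exact: iB.
  by rewrite intB// EML// subee ?intfin// sube0.
have L00 w : (0 <= L w)%E by exact: end_of_ge0.
have NL0 : P.-negligible [set w | at_time N L w <> 0].
  exact: (vanishes_at_end uF mgN NC oG L0 Loo mL LA tN0).
have iNL : P.-integrable setT (EFin \o at_time N L) by exact: (at_time_integrable uF mgN NC).
split.
  by split => //; exact: (running_sup_integral fF rcN cN NC).
split => //.
- move=> B [D mD <-]; apply: sub_sigma_algebra; exists N; last by exists D.
  move=> B' [D' mD' <-]; apply: sub_sigma_algebra; exists N; last by exists D'.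
  by split => // t t0; case: (cN t t t0 (lexx t)).
- move=> A LAA; have mA := FLm _ LAA; rewrite (tN0 _ LAA) -[RHS](integral0 P A).
  apply: ae_eq_integral => //.
    by have /measurable_EFinP := integrable_measurable_fun iNL; exact: measurable_funTS.
  apply: negligibleS NL0 => w /= H H0; apply: H => _.
  by rewrite H0.
Qed.
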